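(* Let $K$ be an algebraically closed field. Let $A=KQ/I$ be an indecomposable finite dimensional symmetric $K$-algebra, where $Q$ is a quiver and $I$ is an admissible ideal of the path algebra $KQ$, such that $\operatorname{rad}(A)^3=0$ and $\operatorname{rad}(A)^2\neq 0$. Then $A$ is a special multiserial algebra and, in particular, $A$ is (isomorphic to) a Brauer configuration algebra.
   Context: Paths are written left to right: $ab$ is the path $a$ followed by $b$ (and $ab=0$ in $KQ$ if not composable). $\operatorname{rad}(A)$ is the Jacobson radical. A finite dimensional $K$-algebra $A$ is symmetric if there is a $K$-linear form $f\colon A\to K$ with $f(xy)=f(yx)$ for all $x,y\in A$ such that $\ker(f)$ contains no nonzero two-sided ideal of $A$. A finite dimensional $K$-algebra is special multiserial if it is Morita equivalent to a quotient $KQ'/I'$ of a path algebra by an admissible ideal such that for every arrow $a$ in $Q'$ there is at most one arrow $b$ with $ab\notin I'$ and at most one arrow $c$ with $ca\notin I'$. A (reduced) Brauer configuration is a tuple $\Gamma=(\Gamma_0,\Gamma_1,\mu,\mathfrak o)$ where $\Gamma_0$ is a finite set of vertices; $\Gamma_1$ is a finite collection of finite multisets of vertices, called polygons; $\mu\colon\Gamma_0\to\{1,2,3,\dots\}$ is a function (the multiplicity function); and $\mathfrak o$ is an orientation. For $\alpha\in\Gamma_0$, $\operatorname{val}(\alpha)$ is the sum over all polygons $V\in\Gamma_1$ of the number of times $\alpha$ occurs in $V$. A vertex $\alpha$ is truncated if it occurs once in exactly one polygon and $\mu(\alpha)=1$, i.e. $\operatorname{val}(\alpha)\mu(\alpha)=1$.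 The orientation $\mathfrak o$ is, for each nontruncated vertex $\alpha$, a choice of cyclic ordering $V_1<V_2<\cdots<V_{\operatorname{val}(\alpha)}\ (<V_1)$ of the polygons containing $\alpha$, counted with repetitions (a polygon containing $\alpha$ exactly $t$ times appears $t$ times); $V_{r+1}$ is called the successor of $V_r$ at $\alpha$ (indices modulo $\operatorname{val}(\alpha)$). One requires: (C1) every vertex lies in at least one polygon; (C2) every polygon has at least two vertices (counted with repetition); (C3) every polygon contains at least one vertex $\alpha$ with $\operatorname{val}(\alpha)\mu(\alpha)>1$; (C4) if a truncated vertex $\alpha$ lies in a polygon $V$, then $V$ is a 2-gon. The quiver $Q_\Gamma$ has one vertex $v$ for each polygon $V\in\Gamma_1$. For each nontruncated $\alpha$ with cyclic ordering $V_1<\cdots<V_m$, $m=\operatorname{val}(\alpha)$, there are arrows $a_1,\dots,a_m$, where $a_r$ goes from $v_r$ to $v_{r+1}$ (with $v_{m+1}=v_1$); the arrows obtained from all nontruncated vertices in this way are pairwise distinct and are all the arrows of $Q_\Gamma$. For such $\alpha$ let $C_j=a_ja_{j+1}\cdots a_m a_1\cdots a_{j-1}$. If $\alpha$ occurs in $V$ and $V=V_{i_1},\dots,V=V_{i_t}$ are all its occurrences in the cyclic ordering at $\alpha$, then the cycles $C_{i_1},\dots,C_{i_t}$ are the special $\alpha$-cycles at $v$. A special cycle is a special $\alpha$-cycle at some $v$ for some $\alpha$. The set $\rho_\Gamma$ consists of: (type one) all $C^{\mu(\alpha)}-(C')^{\mu(\beta)}$ where $V\in\Gamma_1$, $\alpha,\beta$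 are (possibly equal) nontruncated vertices in $V$, $C$ is a special $\alpha$-cycle at $v$ and $C'$ is a special $\beta$-cycle at $v$; (type two) all paths $C^{\mu(\alpha)}a_1$ where $C=a_1\cdots a_m$ is a special $\alpha$-cycle; (type three) all paths $ab$ of length 2 in $Q_\Gamma$ that are not a subpath of any special cycle, except the paths $aa$ where $a$ is the loop associated to a vertex $\alpha$ with $\operatorname{val}(\alpha)=1$ and $\mu(\alpha)>1$. The Brauer configuration algebra associated to $\Gamma$ is $KQ_\Gamma/I_\Gamma$, where $I_\Gamma$ is the ideal generated by $\rho_\Gamma$. *)

(* Defs.v *)
From HB Require Import structures.
From mathcomp Require Import all_boot all_algebra.
From mathcomp Require Import boolp.
From mathcomp Require Import finmap multiset.
From mathcomp Require Import monalg.

Set Implicit Arguments.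
Unset Strict Implicit.
Unset Printing Implicit Defensive.

Import GRing.Theory.
Local Open Scope ring_scope.
Local Open Scope quotient_scope.

Section Ideals.
Variable R : nzRingType.
Implicit Types I J S : R -> Prop.

Definition left_ideal J : Prop :=
  [/\ J 0, forall x y, J x -> J y -> J (x + y) & forall a x, J x -> J (a * x)].

Definition two_sided_ideal J : Prop :=
  left_ideal J /\ forall x a, J x -> J (x * a).

Definition ideal_gen S : R -> Prop :=
  fun x => forall J, two_sided_ideal J -> (forall s, S s -> J s) -> J x.

Lemma ideal_gen_two_sided S : two_sided_ideal (ideal_gen S).
Proof.
split=> [|x a Sx J JI SJ]; last by apply: (proj2 JI); exact: Sx.
split=> [J [[]]|x y Sx Sy J JI SJ|a x Sx J JI SJ] //; have [[J0 JD JM] _] := JI.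
  by apply: JD; [exact: Sx | exact: Sy].
by apply: JM; exact: Sx.
Qed.

Definition ideal_mul I J : R -> Prop := fun x =>
  exists (n : nat) (a b : 'I_n -> R),
    (forall i, I (a i) /\ J (b i)) /\ x = \sum_(i < n) a i * b i.

Fixpoint ideal_pow J (n : nat) : R -> Prop :=
  if n is m.+1 then ideal_mul J (ideal_pow J m) else fun=> True.

Definition maximal_left_ideal J : Prop :=
  [/\ left_ideal J, ~ J 1
    & forall L, left_ideal L -> ~ L 1 -> (forall x, J x -> L x) ->
      forall x, L x -> J x].

Definition jacobson_radical : R -> Prop :=
  fun x => forall J, maximal_left_ideal J -> J x.

End Ideals.

Arguments jacobson_radical R : clear implicits.

(* Algebras of type [algType] are nonzero, so only proper ideals give a
   quotient. *)
Record proper_two_sided_ideal (R : nzRingType) := ProperTwoSidedIdeal {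
  pideal_pred :> R -> Prop;
  pideal_two_sided : two_sided_ideal pideal_pred;
  pideal_proper : ~ pideal_pred 1
}.

Section Quotient.
Variables (K : fieldType) (A : algType K) (I : proper_two_sided_ideal A).

Definition pideal_mem : {pred A} := fun x => `[< I x >].

Lemma pideal_memP x : reflect (I x) (x \in pideal_mem).
Proof. exact: asboolP. Qed.

Lemma pideal_mem_zmod : zmod_closed pideal_mem.
Proof.
have [[I0 ID IMl] _] := pideal_two_sided I.
split=> [|x y /pideal_memP Ix /pideal_memP Iy]; apply/pideal_memP => //.
by apply: ID => //; rewrite -mulN1r; apply: IMl.
Qed.

HB.instance Definition _ := GRing.isZmodClosed.Build A pideal_mem pideal_mem_zmod.

Definition quot_alg : Type := Quotient.quot pideal_mem.

HB.instance Definition _ := GRing.Zmodule.on quot_alg.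
HB.instance Definition _ : EqQuotient A (Quotient.equiv pideal_mem) quot_alg :=
  EqQuotient.on quot_alg.
HB.instance Definition _ :=
  isZmodQuotient.Build A (Quotient.equiv pideal_mem) 0 -%R +%R quot_alg
    (@pi_zeror _ _ _ _ _ (Quotient.quot pideal_mem))
    (@pi_oppr _ _ _ _ _ (Quotient.quot pideal_mem))
    (@pi_addr _ _ _ _ _ (Quotient.quot pideal_mem)).

Lemma quot_alg_eqP x y : reflect (I (x - y)) (\pi_quot_alg x == \pi_quot_alg y).
Proof. by rewrite -(Quotient.idealrBE pideal_mem); exact: pideal_memP. Qed.

Definition quot_one : quot_alg := \pi_quot_alg (1 : A).
Definition quot_mul (u v : quot_alg) : quot_alg := \pi_quot_alg (repr u * repr v).
Definition quot_scale (k : K) (u : quot_alg) : quot_alg := \pi_quot_alg (k *: repr u).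

Lemma reprB x : I (repr (\pi_quot_alg x) - x).
Proof. by apply/quot_alg_eqP; rewrite reprK. Qed.

Lemma quot_mulE x y : quot_mul (\pi x) (\pi y) = \pi_quot_alg (x * y).
Proof.
have [[_ ID IMl] IMr] := pideal_two_sided I.
apply/eqP/quot_alg_eqP; set x' := repr _; set y' := repr _.
rewrite (_ : _ - _ = (x' - x) * y' + x * (y' - y)).
  by apply: ID; [apply: IMr; exact: reprB | apply: IMl; exact: reprB].
by rewrite mulrBl mulrBr addrA subrK.
Qed.

Lemma quot_scaleE k x : quot_scale k (\pi x) = \pi_quot_alg (k *: x).
Proof.
have [[_ _ IMl] _] := pideal_two_sided I.
apply/eqP/quot_alg_eqP; rewrite -scalerBr -[_ - _]mul1r scalerAl.
by apply: IMl; exact: reprB.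
Qed.

Lemma quot_addE x y : \pi_quot_alg x + \pi_quot_alg y = \pi_quot_alg (x + y).
Proof. by rewrite pi_addr. Qed.

Lemma quot_mulA : associative quot_mul.
Proof.
by move=> x y z; rewrite -[x]reprK -[y]reprK -[z]reprK !quot_mulE mulrA.
Qed.
Lemma quot_mul1 : left_id quot_one quot_mul.
Proof. by move=> x; rewrite -[x]reprK quot_mulE mul1r. Qed.
Lemma quot_1mul : right_id quot_one quot_mul.
Proof. by move=> x; rewrite -[x]reprK quot_mulE mulr1. Qed.
Lemma quot_mulDl : left_distributive quot_mul +%R.
Proof.
move=> x y z; rewrite -[x]reprK -[y]reprK -[z]reprK.
by rewrite quot_addE !quot_mulE quot_addE mulrDl.
Qed.
Lemma quot_mulDr : right_distributive quot_mul +%R.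
Proof.
move=> x y z; rewrite -[x]reprK -[y]reprK -[z]reprK.
by rewrite quot_addE !quot_mulE quot_addE mulrDr.
Qed.
Lemma quot_one_neq0 : quot_one != 0.
Proof.
apply/negP; rewrite -[X in _ == X]pi_zeror => /quot_alg_eqP.
by rewrite subr0; exact: pideal_proper.
Qed.

HB.instance Definition _ := GRing.Zmodule_isNzRing.Build quot_alg
  quot_mulA quot_mul1 quot_1mul quot_mulDl quot_mulDr quot_one_neq0.

Lemma quot_scaleA a b u : quot_scale a (quot_scale b u) = quot_scale (a * b) u.
Proof. by rewrite -[u]reprK !quot_scaleE scalerA. Qed.
Lemma quot_scale1 : left_id 1 quot_scale.
Proof. by move=> u; rewrite -[u]reprK quot_scaleE scale1r. Qed.
Lemma quot_scaleDr : right_distributive quot_scale +%R.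
Proof.
move=> a u v; rewrite -[u]reprK -[v]reprK.
by rewrite quot_addE !quot_scaleE quot_addE scalerDr.
Qed.
Lemma quot_scaleDl u : {morph quot_scale^~ u : a b / a + b}.
Proof.
by move=> a b; rewrite -[u]reprK !quot_scaleE quot_addE scalerDl.
Qed.

HB.instance Definition _ := GRing.Zmodule_isLmodule.Build K quot_alg
  quot_scaleA quot_scale1 quot_scaleDr quot_scaleDl.

Lemma quot_scaleAl (a : K) (u v : quot_alg) : a *: (u * v) = (a *: u) * v.
Proof.
rewrite -[LHS]/(quot_scale a (quot_mul u v)) -[RHS]/(quot_mul (quot_scale a u) v).
by rewrite -[u]reprK -[v]reprK !(quot_mulE, quot_scaleE) scalerAl.
Qed.
HB.instance Definition _ :=
  GRing.Lmodule_isLalgebra.Build K quot_alg quot_scaleAl.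

Lemma quot_scaleAr (a : K) (u v : quot_alg) : a *: (u * v) = u * (a *: v).
Proof.
rewrite -[LHS]/(quot_scale a (quot_mul u v)) -[RHS]/(quot_mul u (quot_scale a v)).
by rewrite -[u]reprK -[v]reprK !(quot_mulE, quot_scaleE) scalerAr.
Qed.
HB.instance Definition _ :=
  GRing.Lalgebra_isAlgebra.Build K quot_alg quot_scaleAr.

End Quotient.

Section AlgebraProperties.
Variable K : fieldType.
Implicit Types A B C : algType K.

Definition alg_isomorphic A B : Prop :=
  exists f : {lrmorphism A -> B}, bijective f.

Definition fin_dim A : Prop :=
  exists (n : nat) (b : 'I_n -> A),
    forall x, exists c : 'I_n -> K, x = \sum_(i < n) c i *: b i.

Definition symmetric_algebra A : Prop :=
  fin_dim A /\
  exists f : {scalar A},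
    (forall x y, f (x * y) = f (y * x)) /\
    forall J : A -> Prop, two_sided_ideal J ->
      (forall x, J x -> f x = 0) -> forall x, J x -> x = 0.

(* [algType] excludes the zero algebra, so A, B and C are nonzero here. *)
Definition indecomposable A : Prop :=
  forall B C, ~ alg_isomorphic A (B * C)%type.

End AlgebraProperties.

Record module_functor (R S : nzRingType) := ModuleFunctor {
  fobj :> lmodType R -> lmodType S;
  fmap : forall M N : lmodType R, {linear M -> N} -> {linear fobj M -> fobj N};
  fmap_id : forall M : lmodType R, fmap (idfun : {linear M -> M}) =1 id;
  fmap_comp : forall (M N P : lmodType R)
    (g : {linear N -> P}) (f : {linear M -> N}),
    fmap (g \o f : {linear M -> P}) =1 fmap g \o fmap f
}.

(* K acts on a module over a K-algebra, hence on morphisms, through k%:A. *)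
Definition functor_klinear (K : fieldType) (A B : algType K)
    (F : module_functor A B) : Prop :=
  forall (M N : lmodType A) (k : K) (f g h : {linear M -> N}),
    (forall x, h x = (k%:A : A) *: f x + g x) ->
    forall y, fmap F h y = (k%:A : B) *: fmap F f y + fmap F g y.

Definition natural_iso_id (R S : nzRingType)
    (F : module_functor R S) (G : module_functor S R) : Prop :=
  exists eta : forall M : lmodType R, {linear M -> G (F M)},
    (forall M, bijective (eta M)) /\
    forall (M N : lmodType R) (f : {linear M -> N}) (x : M),
      eta N (f x) = fmap G (fmap F f) (eta M x).

(* K-linear equivalence of the categories of left modules. *)
Definition morita_equivalent (K : fieldType) (A B : algType K) : Prop :=
  exists (F : module_functor A B) (G : module_functor B A),
    [/\ functor_klinear F, functor_klinear G,
        natural_iso_id F G & natural_iso_id G F].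

Record quiver := Quiver {
  qvertex : finType;
  qarrow : finType;
  qsrc : qarrow -> qvertex;
  qtgt : qarrow -> qvertex;
  qvertex_nonempty : (0 < #|qvertex|)%N
}.

Section Paths.
Variable Q : quiver.

Fixpoint is_walk (v : qvertex Q) (s : seq (qarrow Q)) : bool :=
  if s is a :: s' then (qsrc a == v) && is_walk (qtgt a) s' else true.

(* The first component is the starting vertex, so that there is a trivial path
   at every vertex. *)
Definition qpath : Type :=
  {p : qvertex Q * seq (qarrow Q) | is_walk p.1 p.2}.
(* Opaque classical structures: with the transparent ones inherited from lists,
   conversion between finitely supported functions on paths is intractable. *)
HB.instance Definition _ := SubType.on qpath.
HB.instance Definition _ := gen_eqMixin qpath.
HB.instance Definition _ := gen_choiceMixin qpath.

Lemma qpath_eqE (p q : qpath) : (p == q) = (val p == val q).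
Proof. by apply/eqP/eqP => [->|/val_inj]. Qed.


Definition pstart (p : qpath) : qvertex Q := (val p).1.
Definition parrows (p : qpath) : seq (qarrow Q) := (val p).2.
Definition walk_end v (s : seq (qarrow Q)) := last v (map (@qtgt Q) s).
Definition pend (p : qpath) : qvertex Q := walk_end (pstart p) (parrows p).

Lemma is_walk_cat v s1 s2 :
  is_walk v (s1 ++ s2) = is_walk v s1 && is_walk (walk_end v s1) s2.
Proof. by elim: s1 v => //= a s1 IH v; rewrite IH andbA. Qed.

(* The concatenation [p ++ q] is a walk when the endpoints match, so [insub]
   only fails there by the explicit test. *)
Definition pcat (p q : qpath) : option qpath :=
  if pend p == pstart q then insub (pstart p, parrows p ++ parrows q)
  else None.

Definition ptriv (v : qvertex Q) : qpath := exist _ (v, [::]) isT.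

Lemma parrow_subproof (a : qarrow Q) : is_walk (qsrc a, [:: a]).1 (qsrc a, [:: a]).2.
Proof. by rewrite /= eqxx. Qed.
Definition parrow (a : qarrow Q) : qpath :=
  exist _ (qsrc a, [:: a]) (parrow_subproof a).

Lemma pcatE p q r : (pcat p q == Some r) =
  [&& pend p == pstart q, pstart r == pstart p
    & parrows r == parrows p ++ parrows q].
Proof.
rewrite /pcat; case: ifP => //= /eqP pq; case: insubP => [u _ Eu|/negP[]].
  rewrite (inj_eq Some_inj) eq_sym qpath_eqE Eu [val r]surjective_pairing.
  by rewrite xpair_eqE.
by rewrite is_walk_cat (valP p) /= -/(pend p) pq (valP q).
Qed.

Lemma pcat_some p q r : pcat p q = Some r ->
  [/\ pend p = pstart q, pstart r = pstart p
    & parrows r = parrows p ++ parrows q].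
Proof. by move=> /eqP; rewrite pcatE => /and3P[/eqP-> /eqP-> /eqP->]. Qed.

Lemma pcat_none p q : pcat p q = None -> pend p != pstart q.
Proof.
rewrite /pcat; case: ifP => // /eqP pq; case: insubP => //= /negP[].
by rewrite is_walk_cat (valP p) /= -/(pend p) pq (valP q).
Qed.

Lemma pcat_pend p q r : pcat p q = Some r -> pend r = pend q.
Proof.
move=> /pcat_some[pq rp rs]; by rewrite /pend rp rs /walk_end map_cat last_cat -pq.
Qed.

Lemma pcatA p q r :
  obind (fun pq => pcat pq r) (pcat p q) = obind (pcat p) (pcat q r).
Proof.
case E1: (pcat p q) => [pq|]; case E2: (pcat q r) => [qr|] //=.
- have [h1 h2 h3] := pcat_some E1; have [h4 h5 h6] := pcat_some E2.
  case E3: (pcat p qr) => [s|].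
    have [h7 h8 h9] := pcat_some E3.
    by apply/eqP; rewrite pcatE (pcat_pend E1) h4 h8 h2 h9 h6 h3 catA !eqxx.
  by move: (pcat_none E3); rewrite h5 h1 eqxx.
- case E3: (pcat pq r) => [s|] //; have [h _ _] := pcat_some E3.
  by move: (pcat_none E2); rewrite -h (pcat_pend E1) eqxx.
- case E3: (pcat p qr) => [s|] //; have [h _ _] := pcat_some E3.
  have [_ h2 _] := pcat_some E2.
  by move: (pcat_none E1); rewrite h h2 eqxx.
Qed.

Lemma pcat_eq_ptriv p q r v : pcat p q = Some r ->
  (r == ptriv v) = (p == ptriv v) && (q == ptriv v).
Proof.
case: p q r => [[p0 p] Wp] [[q0 q] Wq] [[r0 r] Wr] /pcat_some[].
rewrite /pend /pstart /parrows !qpath_eqE /= !xpair_eqE => pq -> ->.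
by case: p {Wp} pq => [|a p] /= <-; rewrite ?andbF // !andbT; case: eqP.
Qed.

End Paths.

Definition path_alg (K : fieldType) (Q : quiver) : Type := {malg K[qpath Q]}.

Definition path_elt (K : fieldType) (Q : quiver) (p : qpath Q) :
  path_alg K Q := << p >>.

HB.instance Definition _ (K : fieldType) (Q : quiver) :=
  GRing.Lmodule.on (path_alg K Q).

Definition path_elt_mul (K : fieldType) (Q : quiver) (p q : qpath Q) :
    path_alg K Q :=
  if pcat p q is Some r then path_elt K r else 0.

Definition path_mul (K : fieldType) (Q : quiver) (g h : path_alg K Q) :
    path_alg K Q :=
  \sum_(p <- msupp g) \sum_(q <- msupp h)
    (g@_p * h@_q) *: path_elt_mul K p q.

Section PathAlgebra.
Variables (K : fieldType) (Q : quiver).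
Local Notation path_alg := (path_alg K Q).
Local Notation path_elt := (@path_elt K Q).
Local Notation path_elt_mul := (@path_elt_mul K Q).
Local Notation path_mul := (@path_mul K Q).
Implicit Types (p q r : qpath Q) (g h : path_alg).

Definition path_one : path_alg := \sum_(v : qvertex Q) path_elt (ptriv v).

Lemma mcoeff_path_elt p q : (path_elt p)@_q = (p == q)%:R.
Proof. by rewrite /path_elt mcoeffU. Qed.

Lemma msupp_path_elt p : msupp (path_elt p) = [fset p]%fset.
Proof. by rewrite msuppU oner_eq0. Qed.

Lemma path_algE g : g = \sum_(p <- msupp g) g@_p *: path_elt p.
Proof.
rewrite [LHS]monalgE; apply: eq_bigr => p _; apply/malgP => q.
by rewrite mcoeffZ mcoeff_path_elt mcoeffU mulr_natr.
Qed.

Lemma path_alg_ind (P : path_alg -> Prop) : P 0 ->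
  (forall g h, P g -> P h -> P (g + h)) -> (forall c p, P (c *: path_elt p)) ->
  forall g, P g.
Proof. by move=> P0 PD PU g; rewrite [g]path_algE; apply: big_ind. Qed.

Lemma path_mulw (d1 d2 : {fset qpath Q}) g h :
  (msupp g `<=` d1)%fset -> (msupp h `<=` d2)%fset ->
  path_mul g h =
    \sum_(p <- d1) \sum_(q <- d2) (g@_p * h@_q) *: path_elt_mul p q.
Proof.
move=> le1 le2; rewrite /path_mul (big_fset_incl _ le1) /=.
  apply: eq_bigr => p _; apply: big_fset_incl => // q _ /mcoeff_outdom ->.
  by rewrite mulr0 scale0r.
move=> p _ /mcoeff_outdom g1p.
by rewrite big1 // => q _; rewrite g1p mul0r scale0r.
Qed.

Lemma path_mulDl : left_distributive path_mul +%R.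
Proof.
move=> g1 g2 g.
rewrite (@path_mulw (msupp g1 `|` msupp g2)%fset (msupp g)) ?msuppD_le //.
rewrite (@path_mulw (msupp g1 `|` msupp g2)%fset (msupp g) g1) ?fsubsetUl //.
rewrite (@path_mulw (msupp g1 `|` msupp g2)%fset (msupp g) g2) ?fsubsetUr //.
rewrite -big_split /=; apply: eq_bigr => p _.
rewrite -big_split /=; apply: eq_bigr => q _.
by rewrite mcoeffD mulrDl scalerDl.
Qed.

Lemma path_mulDr : right_distributive path_mul +%R.
Proof.
move=> g g1 g2.
rewrite (@path_mulw (msupp g) (msupp g1 `|` msupp g2)%fset) ?msuppD_le //.
rewrite (@path_mulw (msupp g) (msupp g1 `|` msupp g2)%fset g g1) ?fsubsetUl //.
rewrite (@path_mulw (msupp g) (msupp g1 `|` msupp g2)%fset g g2) ?fsubsetUr //.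
rewrite -big_split /=; apply: eq_bigr => p _.
rewrite -big_split /=; apply: eq_bigr => q _.
by rewrite mcoeffD mulrDr scalerDl.
Qed.

Lemma path_mul0 g : path_mul 0 g = 0.
Proof. by apply: (addIr (path_mul 0 g)); rewrite -path_mulDl !add0r. Qed.

Lemma path_0mul g : path_mul g 0 = 0.
Proof. by apply: (addIr (path_mul g 0)); rewrite -path_mulDr !add0r. Qed.

Lemma path_scaleMl (k : K) g h : k *: path_mul g h = path_mul (k *: g) h.
Proof.
rewrite [RHS](path_mulw (msuppZ_le _ _) (fsubset_refl _)) scaler_sumr.
apply: eq_bigr => p _; rewrite scaler_sumr; apply: eq_bigr => q _.
by rewrite scalerA mcoeffZ mulrA.
Qed.

Lemma path_scaleMr (k : K) g h : k *: path_mul g h = path_mul g (k *: h).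
Proof.
rewrite [RHS](path_mulw (fsubset_refl _) (msuppZ_le _ _)) scaler_sumr.
apply: eq_bigr => p _; rewrite scaler_sumr; apply: eq_bigr => q _.
by rewrite scalerA mcoeffZ mulrCA.
Qed.

Lemma path_mul_elt p q :
  path_mul (path_elt p) (path_elt q) = path_elt_mul p q.
Proof.
rewrite /path_mul !msupp_path_elt !big_seq_fset1 !mcoeff_path_elt !eqxx.
by rewrite mulr1 scale1r.
Qed.

Lemma path_mulA : associative path_mul.
Proof.
move=> g1 g2 g3; elim/path_alg_ind: g1 => [|g h IHg IHh|c p].
- by rewrite !path_mul0.
- by rewrite !path_mulDl IHg IHh.
rewrite -!path_scaleMl; congr (_ *: _).
elim/path_alg_ind: g2 => [|g h IHg IHh|d q].
- by rewrite !(path_mul0, path_0mul).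
- by rewrite !(path_mulDl, path_mulDr) IHg IHh.
rewrite -path_scaleMl -!path_scaleMr -path_scaleMl; congr (_ *: _).
elim/path_alg_ind: g3 => [|g h IHg IHh|e r].
- by rewrite !(path_mul0, path_0mul).
- by rewrite !path_mulDr IHg IHh.
rewrite -!path_scaleMr; congr (_ *: _); rewrite !path_mul_elt.
rewrite /path_elt_mul; move: (pcatA p q r).
case: (pcat p q) => [pq|]; case: (pcat q r) => [qr|] /= H;
  by rewrite ?(path_mul0, path_0mul, path_mul_elt) // /path_elt_mul -?H ?H.
Qed.

Lemma path_1mul : left_id path_one path_mul.
Proof.
elim/path_alg_ind => [|g h IHg IHh|c p]; first by rewrite path_0mul.
  by rewrite path_mulDr IHg IHh.
rewrite -path_scaleMr; congr (_ *: _); rewrite /path_one.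
rewrite (big_morph (path_mul^~ _) (fun _ _ => path_mulDl _ _ _) (path_mul0 _)).
rewrite (bigD1 (pstart p)) //= path_mul_elt /path_elt_mul.
have /eqP -> : pcat (ptriv (pstart p)) p == Some p by rewrite pcatE !eqxx.
rewrite big1 ?addr0 // => v nv; rewrite path_mul_elt /path_elt_mul.
by case E: pcat => [r|] //; have [h _ _] := pcat_some E; rewrite -h eqxx in nv.
Qed.

Lemma path_mul1 : right_id path_one path_mul.
Proof.
elim/path_alg_ind => [|g h IHg IHh|c p]; first by rewrite path_mul0.
  by rewrite path_mulDl IHg IHh.
rewrite -path_scaleMl; congr (_ *: _); rewrite /path_one.
rewrite (big_morph (path_mul _) (fun _ _ => path_mulDr _ _ _) (path_0mul _)).
rewrite (bigD1 (pend p)) //= path_mul_elt /path_elt_mul.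
have /eqP -> : pcat p (ptriv (pend p)) == Some p by rewrite pcatE cats0 !eqxx.
rewrite big1 ?addr0 // => v nv; rewrite path_mul_elt /path_elt_mul.
by case E: pcat => [r|] //; have [h _ _] := pcat_some E; rewrite h eqxx in nv.
Qed.

Lemma mcoeff_ptriv1 v : path_one@_(ptriv v) = 1.
Proof.
rewrite /path_one raddf_sum (bigD1 v) //= mcoeff_path_elt eqxx.
rewrite big1 ?addr0 // => w nw.
by rewrite mcoeff_path_elt qpath_eqE /= xpair_eqE (negPf nw).
Qed.

Lemma path_one_neq0 : path_one != 0.
Proof.
have [v _] := card_gt0P (qvertex_nonempty Q); apply/eqP => h.
by move: (mcoeff_ptriv1 v); rewrite h mcoeff0 => /esym/eqP; rewrite oner_eq0.
Qed.

HB.instance Definition _ := GRing.Zmodule_isNzRing.Build path_alg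
  path_mulA path_1mul path_mul1 path_mulDl path_mulDr path_one_neq0.
HB.instance Definition _ :=
  GRing.Lmodule_isLalgebra.Build K path_alg path_scaleMl.
HB.instance Definition _ :=
  GRing.Lalgebra_isAlgebra.Build K path_alg path_scaleMr.

Lemma mcoeff_ptrivM v g h : (g * h)@_(ptriv v) = g@_(ptriv v) * h@_(ptriv v).
Proof.
elim/path_alg_ind: g => [|g g' IH IH'|c p]; first by rewrite mul0r !mcoeff0 mul0r.
  by rewrite mulrDl !mcoeffD IH IH' mulrDl.
rewrite -scalerAl !mcoeffZ -mulrA; congr (_ * _).
elim/path_alg_ind: h => [|h h' IH IH'|d q]; first by rewrite mulr0 !mcoeff0 mulr0.
  by rewrite mulrDr !mcoeffD IH IH' mulrDr.
rewrite -scalerAr !mcoeffZ mulrCA; congr (_ * _).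
rewrite [_ * _]path_mul_elt /path_elt_mul !mcoeff_path_elt -natrM mulnb.
case E: pcat => [r|]; first by rewrite mcoeff_path_elt (pcat_eq_ptriv v E).
rewrite mcoeff0; case: eqP => //= p1; case: eqP => //= q1.
by move: (pcat_none E); rewrite p1 q1 eqxx.
Qed.

Definition arrow (a : qarrow Q) : path_alg := path_elt (parrow a).

Lemma mcoeff_ptriv_arrow v a : (arrow a)@_(ptriv v) = 0.
Proof. by rewrite mcoeff_path_elt qpath_eqE /= xpair_eqE andbF. Qed.

Definition arrow_ideal : path_alg -> Prop :=
  ideal_gen (fun x => exists a, x = arrow a).

Definition admissible (I : proper_two_sided_ideal path_alg) : Prop :=
  (forall x, I x -> ideal_pow arrow_ideal 2 x) /\
  exists m : nat, (2 <= m)%N /\ forall x, ideal_pow arrow_ideal m x -> I x.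

End PathAlgebra.

Arguments arrow K {Q} a.

Definition special_multiserial (K : fieldType) (A : algType K) : Prop :=
  fin_dim A /\
  exists (Q : quiver) (I : proper_two_sided_ideal (path_alg K Q)),
    [/\ admissible I,
        forall a b b' : qarrow Q,
          ~ I (arrow K a * arrow K b) -> ~ I (arrow K a * arrow K b') -> b = b',
        forall a c c' : qarrow Q,
          ~ I (arrow K c * arrow K a) -> ~ I (arrow K c' * arrow K a) -> c = c'
      & morita_equivalent A (quot_alg I)].

Local Open Scope mset_scope.

Definition valency (V P : finType) (polygon : P -> {mset V}) (a : V) : nat :=
  (\sum_(p : P) polygon p a)%N.

(* The polygons form a family indexed by [bpolygon], so that distinct polygons
   may be equal as multisets.  The cyclic ordering at a nontruncated vertex is
   represented by a tuple listing it from an arbitrary starting point; the tuple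
   attached to a truncated vertex is irrelevant. *)
Record brauer_configuration := BrauerConfiguration {
  bvertex : finType;
  bpolygon : finType;
  bpolygon_nonempty : (0 < #|bpolygon|)%N;
  polygon : bpolygon -> {mset bvertex};
  mult : bvertex -> nat;
  orientation : forall a, (valency polygon a).-tuple bpolygon;
  mult_gt0 : forall a, (0 < mult a)%N;
  orientationP : forall a, (1 < valency polygon a * mult a)%N ->
    forall p, count_mem p (orientation a) = polygon p a;
  vertex_in_polygon : forall a, exists p, (0 < polygon p a)%N;
  polygon_size : forall p, (2 <= size (polygon p))%N;
  polygon_nontruncated : forall p,
    exists2 a, (0 < polygon p a)%N & (1 < valency polygon a * mult a)%N;
  polygon_truncated : forall p a, (0 < polygon p a)%N ->
    (valency polygon a * mult a = 1)%N -> size (polygon p) = 2%N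
}.

Section BrauerConfigurationAlgebra.
Variables (K : fieldType) (G : brauer_configuration).

Local Notation val_ a := (valency (@polygon G) a).

Definition nontruncated : Type := {a : bvertex G | (1 < val_ a * mult a)%N}.
HB.instance Definition _ := SubFinite.on nontruncated.

(* The pair (a, r) is the arrow at the vertex a from the polygon in position r
   of the cyclic ordering to the one in the next position. *)
Definition barrow : Type := {a : nontruncated & 'I_(val_ (val a))}.
HB.instance Definition _ := Finite.on barrow.

Definition barrow_vertex (x : barrow) : bvertex G := val (tag x).
Definition bsrc (x : barrow) : bpolygon G :=
  tnth (orientation (barrow_vertex x)) (tagged x).
Definition btgt (x : barrow) : bpolygon G :=
  tnth (orientation (barrow_vertex x)) (ordS (tagged x)).

Definition brauer_quiver : quiver := Quiver bsrc btgt (bpolygon_nonempty G).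

(* Special cycles are indexed by their first arrow: the special a-cycles at a
   polygon p correspond to the arrows (a, r) with source p. *)
Definition special_cycle (x : barrow) : seq barrow :=
  [seq Tagged (fun a : nontruncated => 'I_(val_ (val a))) i
    | i <- traject (@ordS _) (tagged x) (val_ (barrow_vertex x))].

Definition special_cycle_elt (x : barrow) : path_alg K brauer_quiver :=
  \prod_(y <- special_cycle x) arrow K (y : qarrow brauer_quiver).

Definition special_cycle_pow (x : barrow) : path_alg K brauer_quiver :=
  special_cycle_elt x ^+ mult (barrow_vertex x).

(* In [BrauerRelation1], x and y are the first arrows of special cycles at a
   common polygon. *)
Inductive brauer_relation : path_alg K brauer_quiver -> Prop :=
| BrauerRelation1 x y : bsrc x = bsrc y ->
    brauer_relation (special_cycle_pow x - special_cycle_pow y)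
| BrauerRelation2 x :
    brauer_relation
      (special_cycle_pow x * arrow K (x : qarrow brauer_quiver))
| BrauerRelation3 x y : btgt x = bsrc y ->
    (forall z, ~~ infix [:: x; y] (special_cycle z)) ->
    ~ [/\ x = y, val_ (barrow_vertex x) = 1%N
        & (1 < mult (barrow_vertex x))%N] ->
    brauer_relation (arrow K (x : qarrow brauer_quiver) *
                     arrow K (y : qarrow brauer_quiver)).

Lemma mcoeff_special_cycle_pow v x : (special_cycle_pow x)@_(ptriv v) = 0.
Proof.
have E : (special_cycle_elt x)@_(ptriv v) = 0.
  have : (0 < size (special_cycle x))%N.
    by rewrite size_map size_traject (leq_ltn_trans _ (ltn_ord (tagged x))).
  rewrite /special_cycle_elt; case: special_cycle => [//|y s] _.
  by rewrite big_cons mcoeff_ptrivM mcoeff_ptriv_arrow mul0r.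
rewrite /special_cycle_pow; case: mult (mult_gt0 (barrow_vertex x)) => // n _.
by rewrite exprS mcoeff_ptrivM E mul0r.
Qed.

Lemma brauer_ideal_proper : ~ ideal_gen brauer_relation 1.
Proof.
have [v _] := card_gt0P (bpolygon_nonempty G).
move=> /(_ (fun g => g@_(ptriv (v : qvertex brauer_quiver)) = 0)) H.
have: (1 : path_alg K brauer_quiver)@_(ptriv (v : qvertex brauer_quiver)) = 0.
  apply: H => [|_ [x y _|x|x y _ _ _]].
  - split=> [|g a gv]; last by rewrite mcoeff_ptrivM gv mul0r.
    split=> [|g h gv hv|a g gv]; first exact: mcoeff0.
      by rewrite mcoeffD gv hv addr0.
    by rewrite mcoeff_ptrivM gv mulr0.
  - have := mcoeff_special_cycle_pow v x; have := mcoeff_special_cycle_pow v y.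
    move: (special_cycle_pow x) (special_cycle_pow y) => g h hv gv.
    by rewrite mcoeffB gv hv subr0.
  - have := mcoeff_special_cycle_pow v x; move: (special_cycle_pow x) => g gv.
    by rewrite mcoeff_ptrivM gv mul0r.
  - by rewrite mcoeff_ptrivM mcoeff_ptriv_arrow mul0r.
by move/eqP; rewrite mcoeff_ptriv1 oner_eq0.
Qed.

Definition brauer_ideal : proper_two_sided_ideal (path_alg K brauer_quiver) :=
  ProperTwoSidedIdeal (ideal_gen_two_sided brauer_relation) brauer_ideal_proper.

Definition brauer_configuration_algebra : algType K := quot_alg brauer_ideal.

End BrauerConfigurationAlgebra.

Definition is_brauer_configuration_algebra
    (K : fieldType) (A : algType K) : Prop :=
  exists G : brauer_configuration,
    alg_isomorphic A (brauer_configuration_algebra K G).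

(* Main.v *)
(** Let f be the symmetrizing form.  For every vertex v the space e_v rad^2 is
    nonzero: otherwise no arrow joins v to another vertex, so e_v is central,
    hence e_v = 1 by indecomposability and rad^2 = 0.  Its elements z with
    e_v z = z are then determined by f z, and since rad^3 = 0 the symmetric form
    (x, y) |-> f (x y) is nondegenerate on the span of the arrows.  Over an
    algebraically closed field of any characteristic this span has a basis of
    elements b, each running from one vertex to another, with an involution
    b |-> b' such that f (b c) = 1 if c = b' and f (b c) = 0 otherwise.
    Therefore b c = 0 unless c = b', and b b' depends only on the source of b.
    These are the relations of the Brauer configuration algebra whose vertices
    are the orbits of the involution: a fixed point gives a vertex of valency 1
    and multiplicity 2, an orbit of size two a vertex of valency 2 and
    multiplicity 1. *)
From HB Require Import structures.
Require Import Defs.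
From mathcomp Require Import all_boot all_algebra.
From mathcomp Require Import boolp finmap multiset monalg.

Set Implicit Arguments.
Unset Strict Implicit.
Unset Printing Implicit Defensive.

Import GRing.Theory.
Local Open Scope ring_scope.
Local Open Scope quotient_scope.

(** * Algebras, quotients and Morita equivalence *)

Section QuotientMap.
Variables (K : fieldType) (A : algType K) (I : proper_two_sided_ideal A).

Definition quot_map (x : A) : quot_alg I := \pi_(quot_alg I) x.

Lemma quot_map_surj (u : quot_alg I) : exists x, u = quot_map x.
Proof. by exists (repr u); rewrite /quot_map reprK. Qed.

Lemma quot_map_eqP x y : quot_map x = quot_map y <-> I (x - y).
Proof. by split=> [/eqP/quot_alg_eqP|/quot_alg_eqP/eqP]. Qed.

Lemma quot_mapD x y : quot_map (x + y) = quot_map x + quot_map y.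
Proof. by rewrite [RHS]quot_addE. Qed.

Lemma quot_mapM x y : quot_map (x * y) = quot_map x * quot_map y.
Proof. by rewrite [RHS]quot_mulE. Qed.

Lemma quot_mapZ k x : quot_map (k *: x) = k *: quot_map x.
Proof. by rewrite [RHS]quot_scaleE. Qed.

Lemma quot_map_is_linear : linear quot_map.
Proof. by move=> k x y; rewrite quot_mapD quot_mapZ. Qed.

Lemma quot_map_is_monoid_morphism : monoid_morphism quot_map.
Proof. by split=> // x y; apply: quot_mapM. Qed.

HB.instance Definition _ := GRing.isLinear.Build K A (quot_alg I) _ quot_map quot_map_is_linear.
HB.instance Definition _ := GRing.isMonoidMorphism.Build A (quot_alg I) quot_map
  quot_map_is_monoid_morphism.

Lemma quot_map_eq0 x : quot_map x = 0 <-> I x.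
Proof. by rewrite -(linear0 quot_map) quot_map_eqP subr0. Qed.

End QuotientMap.

(** The isomorphism is a chosen section of [F] followed by the projection; two preimages of the same
    element differ by an element of [I], so it is linear and multiplicative. *)
Lemma first_isomorphism (K : fieldType) (R A : algType K)
    (I : proper_two_sided_ideal R) (F : {lrmorphism R -> A}) :
  (forall x, exists g, F g = x) -> (forall g, F g = 0 <-> I g) ->
  alg_isomorphic A (quot_alg I).
Proof.
move=> Fsurj Fker.
have [h Fh] := choice Fsurj.
pose G x := quot_map I (h x).
have GF g : G (F g) = quot_map I g.
  by apply/quot_map_eqP/Fker; rewrite linearB /= Fh subrr.
have Glin : linear G.
  by move=> k x y; rewrite -(Fh x) -(Fh y) -linearP !GF linearP.
have Gmul : monoid_morphism G.
  split=> [|x y]; first by rewrite -(rmorph1 F) GF rmorph1.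
  by rewrite -(Fh x) -(Fh y) -rmorphM !GF rmorphM.
pose Gl := GRing.isLinear.Build K A (quot_alg I) _ G Glin.
pose Gm := GRing.isMonoidMorphism.Build A (quot_alg I) G Gmul.
pose GL : {lrmorphism A -> quot_alg I} := HB.pack G Gl Gm.
exists GL; exists (fun u => F (repr u)) => [x|u] /=.
  rewrite -[RHS]Fh; apply/eqP; rewrite -subr_eq0 -linearB; apply/eqP/Fker.
  by apply/quot_map_eqP; rewrite /quot_map reprK.
by rewrite GF /quot_map reprK.
Qed.

(** * Isomorphic algebras are Morita equivalent *)

Section RestrictionOfScalars.
Variables (K : fieldType) (A B : algType K) (f : {lrmorphism B -> A}).

(** An alias keeping only the additive group, so that the action of [B] does not compete with that
    of [A]. *)
Definition restrict_scalars (M : lmodType A) : Type := M.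
HB.instance Definition _ (M : lmodType A) := GRing.Zmodule.on (restrict_scalars M).

Section OneModule.
Variable M : lmodType A.
Definition restrict_scale (b : B) (x : restrict_scalars M) : restrict_scalars M :=
  f b *: (x : M).
Lemma restrict_scaleA a b x :
  restrict_scale a (restrict_scale b x) = restrict_scale (a * b) x.
Proof. by rewrite /restrict_scale scalerA rmorphM. Qed.
Lemma restrict_scale1 : left_id 1 restrict_scale.
Proof. by move=> x; rewrite /restrict_scale rmorph1 scale1r. Qed.
Lemma restrict_scaleDr : right_distributive restrict_scale +%R.
Proof. by move=> a x y; apply: scalerDr. Qed.
Lemma restrict_scaleDl x : {morph restrict_scale^~ x : a b / a + b}.
Proof. by move=> a b; rewrite /restrict_scale rmorphD scalerDl. Qed.
HB.instance Definition _ := GRing.Zmodule_isLmodule.Build B (restrict_scalars M)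
  restrict_scaleA restrict_scale1 restrict_scaleDr restrict_scaleDl.
Definition restrict_obj : lmodType B := restrict_scalars M.
Lemma restrict_scalarsE (b : B) (x : restrict_obj) : b *: x = (f b *: (x : M) : M).
Proof. by []. Qed.
End OneModule.

Section OneMorphism.
Variables (M N : lmodType A) (g : {linear M -> N}).
Definition restrict_fun : restrict_obj M -> restrict_obj N := g.
Lemma restrict_fun_is_linear : linear restrict_fun.
Proof. by move=> b x y; rewrite !restrict_scalarsE; apply: linearP. Qed.
HB.instance Definition _ := GRing.isLinear.Build B (restrict_obj M)
  (restrict_obj N) _ restrict_fun restrict_fun_is_linear.
Definition restrict_mor : {linear restrict_obj M -> restrict_obj N} := restrict_fun.
End OneMorphism.

Definition restriction_functor : module_functor A B :=
  @ModuleFunctor A B restrict_obj restrict_mor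
    (fun _ _ => erefl) (fun _ _ _ _ _ _ => erefl).

Lemma restriction_klinear : functor_klinear restriction_functor.
Proof.
move=> M N k u v w E y.
by rewrite !restrict_scalarsE linearZ /= rmorph1; apply: E.
Qed.

End RestrictionOfScalars.

(** After both restrictions [a] acts as [f (g a) = a], so the identity map is already linear. *)
Lemma restriction_natural_iso_id (K : fieldType) (A B : algType K)
    (f : {lrmorphism B -> A}) (g : {lrmorphism A -> B}) :
  cancel g f -> natural_iso_id (restriction_functor f) (restriction_functor g).
Proof.
move=> gK.
have lin (M : lmodType A) :
    linear (id : M -> restriction_functor g (restriction_functor f M)).
  by move=> a x y; rewrite !restrict_scalarsE gK.
pose eta (M : lmodType A) : {linear M -> restriction_functor g (restriction_functor f M)} :=
  HB.pack (id : M -> restriction_functor g (restriction_functor f M))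
    (GRing.isLinear.Build A M _ _ _ (lin M)).
by exists eta; split=> [M|//]; exists id.
Qed.

Lemma alg_isomorphic_morita (K : fieldType) (A B : algType K) :
  alg_isomorphic A B -> morita_equivalent A B.
Proof.
move=> [g [f gK fK]].
have flin : linear f.
  by move=> k x y; apply: (can_inj gK); rewrite fK linearP /= !fK.
have fmul : monoid_morphism f.
  by split=> [|x y]; apply: (can_inj gK); rewrite fK ?rmorph1 ?rmorphM /= ?fK.
pose fl := GRing.isLinear.Build K B A _ f flin.
pose fm := GRing.isMonoidMorphism.Build B A f fmul.
pose F : {lrmorphism B -> A} := HB.pack f fl fm.
exists (restriction_functor F), (restriction_functor g); split.
- exact: restriction_klinear.
- exact: restriction_klinear.
- exact: (@restriction_natural_iso_id _ _ _ F g).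
- exact: (@restriction_natural_iso_id _ _ _ g F).
Qed.

(** * Central idempotents of an indecomposable algebra *)

Section CentralIdempotent.
Variables (K : fieldType) (A : algType K) (c : A).
Hypotheses (cC : forall x, c * x = x * c) (cc : c * c = c).

Lemma annihilator_two_sided : two_sided_ideal (fun x => c * x = 0).
Proof.
split=> [|x a cx]; last by rewrite mulrA cx mul0r.
split=> [|x y cx cy|a x cx]; first by rewrite mulr0.
  by rewrite mulrDr cx cy addr0.
by rewrite mulrA cC -mulrA cx mulr0.
Qed.

Definition annihilator (c0 : c != 0) : proper_two_sided_ideal A.
Proof.
apply: (ProperTwoSidedIdeal annihilator_two_sided).
by rewrite mulr1; apply/eqP.
Defined.

End CentralIdempotent.

(* The factors are quotients of [A] rather than corners [c A] and [(1 - c) A],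
   which are not [algType]s with the unit of [A]. *)
Lemma indecomposable_central_idempotent (K : fieldType) (A : algType K) (c : A) :
  indecomposable A -> (forall x, c * x = x * c) -> c * c = c -> c = 0 \/ c = 1.
Proof.
move=> indA cC cc.
have dC x : (1 - c) * x = x * (1 - c) by rewrite mulrBl mulrBr cC mul1r mulr1.
have [->|c0] := eqVneq c 0; first by left.
have [/subr0_eq<-|d0] := eqVneq (1 - c) 0; first by right.
case: (indA (quot_alg (annihilator cC c0)) (quot_alg (annihilator dC d0))).
pose F (x : A) := (quot_map (annihilator cC c0) x, quot_map (annihilator dC d0) x).
have Flin : linear F by move=> k x y; rewrite /F !linearP.
have Fmul : monoid_morphism F by split=> [|x y]; rewrite /F ?rmorph1 ?rmorphM.
pose Fl := GRing.isLinear.Build K A _ _ F Flin.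
pose Fm := GRing.isMonoidMorphism.Build A _ F Fmul.
pose FL : {lrmorphism A -> (quot_alg (annihilator cC c0) * quot_alg (annihilator dC d0))%type}
  := HB.pack F Fl Fm.
(* The inverse glues two classes. Changing a representative adds an element killed by [c],
   respectively by [1 - c]. *)
exists FL; exists (fun u => c * repr u.1 + (1 - c) * repr u.2) => [x|[u w]] /=.
  have /eqP := reprB (annihilator cC c0) x.
  have /eqP := reprB (annihilator dC d0) x.
  rewrite !mulrBr !subr_eq0 => /eqP -> /eqP ->.
  by rewrite -mulrDl addrC subrK mul1r.
have cd : c * (1 - c) = 0 by rewrite mulrBr mulr1 cc subrr.
have dc : (1 - c) * c = 0 by rewrite mulrBl mul1r cc subrr.
have dd : (1 - c) * (1 - c) = 1 - c by rewrite mulrBr mulr1 dc subr0.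
rewrite -[u in RHS]reprK -[w in RHS]reprK /F.
congr pair; apply/quot_map_eqP => /=; rewrite mulrBr mulrDr !mulrA.
  by rewrite cc cd mul0r addr0 subrr.
by rewrite dc dd mul0r add0r subrr.
Qed.

(** If a maximal left ideal [J] misses [x], then [J + N] contains 1, so some [1 - n] with [n]
    nilpotent lies in [J]; but [1 - n] is invertible. *)
Lemma nilpotent_sub_jacobson (R : nzRingType) (N : R -> Prop) (m : nat) :
  two_sided_ideal N -> (forall x, N x -> x ^+ m = 0) ->
  forall x, N x -> jacobson_radical R x.
Proof.
move=> [[N0 ND NMl] NMr] Nm x Nx J [[J0 JD JM] J1 Jmax].
apply: contrapT => nJx.
pose L y := exists j n, [/\ J j, N n & y = j + n].
have JL y : J y -> L y by move=> Jy; exists y, 0; rewrite addr0.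
apply: nJx; apply: (Jmax L) => //; last by exists 0, x; rewrite add0r.
  split; first exact: JL.
    move=> _ _ [j [n [Jj Nn ->]]] [j' [n' [Jj' Nn' ->]]]; exists (j + j'), (n + n').
    by split; [apply: JD | apply: ND | rewrite addrACA].
  move=> a _ [j [n [Jj Nn ->]]]; exists (a * j), (a * n).
  by split; [apply: JM | apply: NMl | rewrite mulrDr].
move=> [j [n [Jj Nn E]]]; apply: J1.
(* The geometric series inverts [1 - n]. *)
have := JM (\sum_(i < m) n ^+ i) _ Jj.
rewrite (_ : j = 1 - n); last by rewrite E addrK.
suff -> : (\sum_(i < m) n ^+ i) * (1 - n) = 1 by [].
have cn : GRing.comm (1 - n) (\sum_(i < m) n ^+ i).
  by apply: commr_sum => i _; apply/commr_sym/commrB; rewrite /GRing.comm;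
     rewrite ?mulr1 ?mul1r // -exprS -exprSr.
by rewrite -cn -[1 - n]opprB mulNr -subrX1 Nm // opprB subr0.
Qed.

(** * Path algebras *)

Section PathLength.
Variables (K : fieldType) (Q : quiver).
Implicit Types (p q r : qpath Q) (g h : path_alg K Q).

Lemma path_mulE p q : path_elt K p * path_elt K q = path_elt_mul K p q.
Proof. exact: path_mul_elt. Qed.

Lemma path_elt_cons p a s : parrows p = a :: s ->
  exists2 p', parrows p' = s & path_elt K p = arrow K a * path_elt K p'.
Proof.
case: p => [[v t] W]; rewrite /parrows /= => E; subst t.
have /andP[/eqP Ev Ws] := W.
pose p' : qpath Q := exist _ (qtgt a, s) Ws; exists p' => //.
rewrite path_mulE /path_elt_mul; set p : qpath Q := exist _ _ _.
have /eqP -> // : pcat (parrow a) p' == Some p.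
by rewrite pcatE /pend /pstart /parrows /= Ev !eqxx.
Qed.

Lemma parrows0 p : parrows p = [::] -> p = ptriv (pstart p).
Proof. by case: p => [[v s] W]; rewrite /parrows /= => E; subst s; apply: val_inj. Qed.

Lemma parrows1 p a : parrows p = [:: a] -> p = parrow a.
Proof.
case: p => [[v s] W]; rewrite /parrows /= => E; subst s; apply: val_inj => /=.
by have /andP[/eqP-> _] := W.
Qed.

(** The [n]-th power of the arrow ideal, described by coefficients; see [arrow_ideal_powP]. *)
Definition paths_ge n g := forall p, (size (parrows p) < n)%N -> g@_p = 0.

Lemma paths_ge_supp n g p : paths_ge n g -> p \in msupp g -> (n <= size (parrows p))%N.
Proof.
by move=> gn; apply: contraLR; rewrite -ltnNge -mcoeff_eq0 => /gn ->.
Qed.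

Lemma paths_ge0 n : paths_ge n 0.
Proof. by move=> p _; rewrite mcoeff0. Qed.

Lemma paths_geD n g h : paths_ge n g -> paths_ge n h -> paths_ge n (g + h).
Proof. by move=> gn hn p np; rewrite mcoeffD gn // hn // addr0. Qed.

Lemma paths_geZ n c g : paths_ge n g -> paths_ge n (c *: g).
Proof. by move=> gn p np; rewrite mcoeffZ gn // mulr0. Qed.

Lemma paths_geN n g : paths_ge n g -> paths_ge n (- g).
Proof. by move=> gn p np; rewrite mcoeffN gn // oppr0. Qed.

Lemma paths_ge_elt n p : (n <= size (parrows p))%N -> paths_ge n (path_elt K p).
Proof.
move=> np q nq; rewrite mcoeff_path_elt; case: eqP => // E.
by move: nq; rewrite -E ltnNge np.
Qed.

Lemma paths_geM n m g h : paths_ge n g -> paths_ge m h -> paths_ge (n + m) (g * h).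
Proof.
move=> gn hm; rewrite [g * h]/(path_mul g h) /path_mul.
rewrite big_seq; apply: (big_ind (paths_ge (n + m))) => [||p /(paths_ge_supp gn) np].
- exact: paths_ge0.
- by move=> *; apply: paths_geD.
rewrite big_seq; apply: (big_ind (paths_ge (n + m))) => [||q /(paths_ge_supp hm) mq].
- exact: paths_ge0.
- by move=> *; apply: paths_geD.
apply: paths_geZ; rewrite /path_elt_mul.
case E: pcat => [r|]; last exact: paths_ge0.
have [_ _ Er] := pcat_some E.
by apply: paths_ge_elt; rewrite Er size_cat leq_add.
Qed.

Lemma paths_ge_two_sided n : two_sided_ideal (paths_ge n).
Proof.
split; first split.
- exact: paths_ge0.
- by move=> *; apply: paths_geD.
- by move=> a x xn; rewrite -[n]add0n; apply: paths_geM.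
- by move=> x a xn; rewrite -[n]addn0; apply: paths_geM.
Qed.

Lemma paths_ge_arrow a : paths_ge 1 (arrow K a).
Proof. exact: paths_ge_elt. Qed.

Lemma arrow_ideal_paths_ge g : arrow_ideal g -> paths_ge 1 g.
Proof.
apply; first exact: paths_ge_two_sided.
by move=> _ [a ->]; apply: paths_ge_arrow.
Qed.

Lemma arrow_ideal_arrow (a : qarrow Q) : arrow_ideal (arrow K a).
Proof. by move=> J JI; apply; exists a. Qed.

Lemma arrow_ideal_powP n g : ideal_pow (@arrow_ideal K Q) n g <-> paths_ge n g.
Proof.
split; elim: n g => [|n IH] g //=.
  move=> [m [a [b [ab ->]]]].
  apply: (big_ind (paths_ge n.+1)) => [||i _]; first exact: paths_ge0.
    by move=> *; apply: paths_geD.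
  have [/arrow_ideal_paths_ge ai /IH bi] := ab i.
  by rewrite -[n.+1]add1n; apply: paths_geM.
(* For the converse, split the first arrow off every path in the support of [g]. *)
move=> gn; pose s := in_tuple (msupp g).
have /choice[ab abP] : forall i : 'I_(size (msupp g)), exists ab : path_alg K Q * path_alg K Q,
    [/\ arrow_ideal ab.1, ideal_pow (@arrow_ideal K Q) n ab.2
      & g@_(tnth s i) *: path_elt K (tnth s i) = ab.1 * ab.2].
  move=> i; have /(paths_ge_supp gn) := mem_tnth i s.
  case E: parrows => [//|a t] /= tn.
  have [p' Ep' ->] := path_elt_cons E.
  exists (arrow K a, g@_(tnth s i) *: path_elt K p'); split => /=.
  - exact: arrow_ideal_arrow.
  - by apply: IH; apply: paths_geZ; apply: paths_ge_elt; rewrite Ep'.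
  - by rewrite scalerAr.
exists (size (msupp g)), (fun i => (ab i).1), (fun i => (ab i).2); split.
  by move=> i; have [] := abP i.
rewrite [LHS]path_algE (big_tnth _ _ (msupp g)) /=; apply: eq_bigr => i _.
by have [_ _ <-] := abP i.
Qed.

Lemma path_elt_take n p : (n <= size (parrows p))%N ->
  exists p', path_elt K p = \prod_(a <- take n (parrows p)) arrow K a * path_elt K p'.
Proof.
elim: n p => [|n IH] p; first by exists p; rewrite take0 big_nil mul1r.
case E: (parrows p) => [//|a t] /= nt; have [p' Ep' ->] := path_elt_cons E.
have [|p'' ->] := IH p'; first by rewrite Ep'.
by exists p''; rewrite big_cons mulrA Ep'.
Qed.

(** A path of length at least [n] is a multiple of the product of its first [n] arrows. *)
Lemma paths_ge_sub n (J : path_alg K Q -> Prop) : two_sided_ideal J ->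
  (forall r : seq (qarrow Q), size r = n -> J (\prod_(a <- r) arrow K a)) ->
  forall g, paths_ge n g -> J g.
Proof.
move=> [[J0 JD JMl] JMr] Jn g gn; rewrite [g]path_algE big_seq.
apply: (big_ind J) => // p /(paths_ge_supp gn) np.
rewrite -[path_elt K p]mul1r scalerAl; apply: JMl.
by have [p' ->] := path_elt_take np; apply: JMr; apply: Jn; rewrite size_takel.
Qed.

Lemma mcoeff_arrow (a b : qarrow Q) : (arrow K a)@_(parrow b) = (a == b)%:R.
Proof.
rewrite mcoeff_path_elt; congr (_ %:R); congr nat_of_bool.
by apply/eqP/eqP => [/(congr1 (@parrows Q)) [->]|->].
Qed.

(** The last sum runs over all pairs of arrows, since noncomposable pairs contribute 0. *)
Lemma path_alg_span (J : path_alg K Q -> Prop) g : two_sided_ideal J ->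
  (forall h, paths_ge 3 h -> J h) ->
  exists (a : qvertex Q -> K) (b : qarrow Q -> K) (c : qarrow Q * qarrow Q -> K),
  J (g - (\sum_v a v *: path_elt K (ptriv v) + \sum_i b i *: arrow K i +
          \sum_ij c ij *: (arrow K ij.1 * arrow K ij.2))).
Proof.
move=> [[J0 JD JMl] JMr] J3.
elim/path_alg_ind: g => [|g g' [a [b [c H]]] [a' [b' [c' H']]]|k p].
- exists (fun=> 0), (fun=> 0), (fun=> 0).
  by rewrite !big1 ?addr0 ?subr0 // => *; rewrite scale0r.
- exists (fun v => a v + a' v), (fun v => b v + b' v), (fun v => c v + c' v).
  have split_sum (T : finType) (V : lmodType K) (F : T -> V) (d d' : T -> K) :
      \sum_i (d i + d' i) *: F i = \sum_i d i *: F i + \sum_i d' i *: F i.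
    by rewrite -big_split; apply: eq_bigr => i _; rewrite scalerDl.
  rewrite !split_sum.
  move: (JD _ _ H H'); rewrite addrACA -opprD; congr (J (_ - _)).
  by rewrite addrACA; congr (_ + _); rewrite addrACA.
have delta (T : finType) (V : lmodType K) (F : T -> V) i :
    \sum_j (if j == i then k else 0) *: F j = k *: F i.
  rewrite (bigD1 i) //= eqxx big1 ?addr0 // => j /negPf ->; exact: scale0r.
have zero (T : finType) (V : lmodType K) (F : T -> V) : \sum_j 0 *: F j = 0.
  by rewrite big1 // => j _; rewrite scale0r.
have [p3|] := leqP 3 (size (parrows p)).
  exists (fun=> 0), (fun=> 0), (fun=> 0); rewrite !zero !addr0 subr0.
  by apply: J3; apply: paths_geZ; apply: paths_ge_elt.
case E: (parrows p) => [|x [|y [|z s]]] //= _.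
- exists (fun v => if v == pstart p then k else 0), (fun=> 0), (fun=> 0).
  by rewrite delta !zero !addr0 -(parrows0 E) subrr.
- exists (fun=> 0), (fun y => if y == x then k else 0), (fun=> 0).
  by rewrite delta !zero addr0 add0r (parrows1 E) subrr.
have [p1 E1 ->] := path_elt_cons E.
exists (fun=> 0), (fun=> 0), (fun ij => if ij == (x, y) then k else 0).
by rewrite delta !zero !add0r (parrows1 E1) subrr.
Qed.

End PathLength.

(** * The universal property of the path algebra *)

Section PathLift.
Variables (K : fieldType) (Q : quiver) (A : algType K).
Variables (e : qvertex Q -> A) (u : qarrow Q -> A).
Hypotheses (ee : forall v w, e v * e w = if v == w then e v else 0)
  (e1 : \sum_v e v = 1)
  (eu : forall a, e (qsrc a) * u a = u a) (ue : forall a, u a * e (qtgt a) = u a).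
Implicit Types (p q r : qpath Q) (g h : path_alg K Q).

(** The leading idempotent matters for trivial paths only, where the product of arrows is empty. *)
Definition path_eval p : A := e (pstart p) * \prod_(a <- parrows p) u a.

Lemma path_eval_start p : e (pstart p) * path_eval p = path_eval p.
Proof. by rewrite /path_eval mulrA ee eqxx. Qed.

Lemma path_eval_end p : path_eval p * e (pend p) = path_eval p.
Proof.
rewrite /path_eval /pend /parrows /pstart -!mulrA; case: p => [[v s] W] /=.
suff: is_walk v s -> e v * ((\prod_(a <- s) u a) * e (walk_end v s)) = e v * \prod_(a <- s) u a.
  exact.
elim: s v {W} => [|a s IH] v /=; first by rewrite big_nil mul1r mulr1 ee eqxx.
case/andP=> /eqP <- /IH E; rewrite big_cons -{1 2}[u a]ue -!mulrA.
by congr (_ * (_ * _)); rewrite -E.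
Qed.

(** Insert the idempotents at the end of [p] and at the start of [q]: they are orthogonal when the
    paths do not compose. *)
Lemma path_evalM p q :
  path_eval p * path_eval q = if pcat p q is Some r then path_eval r else 0.
Proof.
case E: pcat => [r|].
  have [Epq Er Es] := pcat_some E.
  rewrite {2}/path_eval mulrA -Epq path_eval_end.
  by rewrite /path_eval Er Es big_cat mulrA.
rewrite -path_eval_end -(path_eval_start q) -mulrA [e _ * (_ * _)]mulrA ee.
by rewrite (negPf (pcat_none E)) mul0r mulr0.
Qed.

Definition path_lift g : A := \sum_(p <- msupp g) g@_p *: path_eval p.

Lemma path_liftw (d : {fset qpath Q}) g : (msupp g `<=` d)%fset ->
  path_lift g = \sum_(p <- d) g@_p *: path_eval p.
Proof.
move=> gd; rewrite /path_lift (big_fset_incl _ gd) // => p _ /mcoeff_outdom ->.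
by rewrite scale0r.
Qed.

Lemma path_lift_is_linear : linear path_lift.
Proof.
move=> k g h; pose d := (msupp g `|` msupp h)%fset.
have gd : (msupp g `<=` d)%fset by apply: fsubsetUl.
have hd : (msupp h `<=` d)%fset by apply: fsubsetUr.
rewrite (path_liftw gd) (path_liftw hd) (@path_liftw d).
  rewrite scaler_sumr -big_split; apply: eq_bigr => p _.
  by rewrite mcoeffD mcoeffZ scalerDl scalerA.
apply: fsubset_trans (msuppD_le _ _) _; rewrite fsubUset hd andbT.
exact: fsubset_trans (msuppZ_le _ _) gd.
Qed.
HB.instance Definition _ := GRing.isLinear.Build K (path_alg K Q) A _ path_lift
  path_lift_is_linear.

Lemma path_lift_elt p : path_lift (path_elt K p) = path_eval p.
Proof.
by rewrite /path_lift msupp_path_elt big_seq_fset1 mcoeff_path_elt eqxx scale1r.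
Qed.

Lemma path_lift_triv v : path_lift (path_elt K (ptriv v)) = e v.
Proof. by rewrite path_lift_elt /path_eval /= big_nil mulr1. Qed.

Lemma path_lift_arrow a : path_lift (arrow K a) = u a.
Proof. by rewrite path_lift_elt /path_eval /= big_seq1 eu. Qed.

Lemma path_lift_is_monoid_morphism : monoid_morphism path_lift.
Proof.
split=> [|g h].
  rewrite [1 in LHS]/(path_one K Q) linear_sum -e1.
  by apply: eq_bigr => v _; apply: path_lift_triv.
elim/path_alg_ind: g => [|g g' IH IH'|c p].
- by rewrite mul0r linear0 mul0r.
- by rewrite mulrDl !linearD /= IH IH' mulrDl.
rewrite -scalerAl !linearZ /= -scalerAl; congr (_ *: _).
elim/path_alg_ind: h => [|h h' IH IH'|d q].
- by rewrite mulr0 linear0 mulr0.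
- by rewrite mulrDr !linearD /= IH IH' mulrDr.
rewrite -scalerAr !linearZ /= -scalerAr; congr (_ *: _).
rewrite path_mulE !path_lift_elt path_evalM /path_elt_mul.
by case: pcat => [r|]; rewrite ?path_lift_elt ?linear0.
Qed.
Definition path_lift_morphism : {lrmorphism path_alg K Q -> A} :=
  HB.pack path_lift
    (GRing.isMonoidMorphism.Build (path_alg K Q) A path_lift path_lift_is_monoid_morphism).

Lemma path_lift_morphism_triv v : path_lift_morphism (path_elt K (ptriv v)) = e v.
Proof. exact: path_lift_triv. Qed.

Lemma path_lift_morphism_arrow a : path_lift_morphism (arrow K a) = u a.
Proof. exact: path_lift_arrow. Qed.

End PathLift.


(** * Brauer configurations with special cycles of total length two *)

Section TwoStepBrauerConfiguration.
Variables (K : fieldType) (G : brauer_configuration).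
Local Notation val_ a := (valency (@polygon G) a).
Hypothesis val_mult2 : forall a : nontruncated G, (val_ (val a) * mult (val a) = 2)%N.

Local Notation QG := (brauer_quiver G).
Local Notation IG := (ideal_gen (brauer_relation (K := K) (G := G))).
Local Notation ar x := (arrow K ((x : barrow G) : qarrow QG)).
Implicit Types (x y z : barrow G) (g : path_alg K QG).

(* The only arrow [y] for which the path [x y] is nonzero in the algebra. *)
Definition bnext x : barrow G :=
  Tagged (fun a : nontruncated G => 'I_(val_ (val a))) (ordS (tagged x)).

Lemma val_mult_cases (a : nontruncated G) :
  val_ (val a) = 1%N /\ mult (val a) = 2%N \/ val_ (val a) = 2%N /\ mult (val a) = 1%N.
Proof.
move: (val_mult2 a).
case: (val_ _) => [|[|[|n]]] //.
- by rewrite mul1n => ->; left.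
- by case: (mult _) => [|[|[|m]]] // _; right.
- by case: (mult _) => [|[|m]] //; rewrite mulnC.
Qed.

(** The cyclic shift of one or two positions is an involution. *)
Lemma bnextK x : bnext (bnext x) = x.
Proof.
case: x => a i; rewrite /bnext /=; congr existT; apply: ord_inj => /=.
by have [[E _]|[E _]] := val_mult_cases a; case: i => i /=; rewrite E; case: i => [|[|i]].
Qed.

Lemma special_cycle_loop x : val_ (barrow_vertex x) = 1%N ->
  special_cycle x = [:: x] /\ bnext x = x.
Proof.
case: x => a i; rewrite /barrow_vertex /= => E; split.
  rewrite /special_cycle /= /barrow_vertex /=.
  by rewrite (congr1 (traject (@ordS _) i) E).
rewrite /bnext /=; congr existT; apply: ord_inj => /=.
by case: i => i /=; rewrite E; case: i => [|[|i]].
Qed.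

Lemma special_cycle_pair x : val_ (barrow_vertex x) = 2%N ->
  special_cycle x = [:: x; bnext x].
Proof.
case: x => a i; rewrite /barrow_vertex /= => E.
rewrite /special_cycle /= /barrow_vertex /=.
by rewrite (congr1 (traject (@ordS _) i) E).
Qed.

(** Either a loop is squared or a 2-cycle is run through once; both give this path. *)
Lemma special_cycle_powE x : special_cycle_pow K x = ar x * ar (bnext x).
Proof.
have [[E Em]|[E Em]] : _ \/ _ := val_mult_cases (tag x);
    rewrite /special_cycle_pow /special_cycle_elt /barrow_vertex Em.
  by have [-> ->] := special_cycle_loop E; rewrite big_seq1.
by rewrite special_cycle_pair // big_cons big_seq1.
Qed.

Lemma brauer_ideal_rel g : brauer_relation g -> IG g.
Proof. by move=> gr J _; apply. Qed.

Lemma brauer_ideal_cycleB x y : bsrc x = bsrc y ->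
  IG (ar x * ar (bnext x) - ar y * ar (bnext y)).
Proof.
move=> xy; rewrite -!special_cycle_powE; apply: brauer_ideal_rel.
exact: BrauerRelation1.
Qed.

Lemma arrowM_neq0 (Q : quiver) (a b : qarrow Q) :
  arrow K a * arrow K b <> 0 -> qtgt a = qsrc b.
Proof.
rewrite /arrow path_mulE /path_elt_mul; case E: pcat => [r|] // _.
by have [] := pcat_some E.
Qed.

(** A composable pair falls under type three, because special cycles contain no other paths of
    length 2 than [x] followed by [bnext x]; the excepted loops satisfy [bnext x = x]. *)
Lemma brauer_ideal_mismatch x y : y <> bnext x -> IG (ar x * ar y).
Proof.
move=> yx; have [->|/eqP/arrowM_neq0 xy] := eqVneq (ar x * ar y) 0.
  by case: (ideal_gen_two_sided (brauer_relation (K := K) (G := G))) => [[]].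
apply: brauer_ideal_rel; apply: BrauerRelation3 => //.
  move=> z; apply/negP; case: (val_mult_cases (tag z)) => [[E _]|[E _]].
    by have [-> _] := special_cycle_loop E; rewrite /= !andbF.
  rewrite special_cycle_pair //= !andbF !andbT !orbF.
  by case/andP=> /eqP xz /eqP; rewrite -xz.
case=> xy1 E _; apply: yx; rewrite -xy1.
by have [_ ->] := special_cycle_loop E.
Qed.

(** Without a mismatch the path is [x], [bnext x], [x], which is a relation of type two. *)
Lemma brauer_ideal_cube x y z : IG (ar x * ar y * ar z).
Proof.
have [_ IMr] := ideal_gen_two_sided (brauer_relation (K := K) (G := G)).
have [[_ _ IMl] _] := ideal_gen_two_sided (brauer_relation (K := K) (G := G)).
have [Ey|/eqP/brauer_ideal_mismatch] := eqVneq y (bnext x); last exact: IMr.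
have [Ez|/eqP/brauer_ideal_mismatch] := eqVneq z (bnext y); last first.
  by rewrite -mulrA; apply: IMl.
rewrite Ez Ey bnextK -special_cycle_powE.
by apply: brauer_ideal_rel; apply: BrauerRelation2.
Qed.

Lemma brauer_ideal_paths_ge3 g : paths_ge 3 g -> IG g.
Proof.
apply: paths_ge_sub; first exact: ideal_gen_two_sided.
case=> [|x [|y [|z [|]]]] // _; rewrite !big_cons big_nil mulr1 mulrA.
exact: brauer_ideal_cube.
Qed.

(** A type three relation is always a mismatch: for valency 1 the square of the loop is excepted,
    and for valency 2 [x] followed by [bnext x] is a special cycle. *)
Lemma brauer_ideal_min (J : path_alg K QG -> Prop) : two_sided_ideal J ->
  (forall x y, bsrc x = bsrc y -> J (ar x * ar (bnext x) - ar y * ar (bnext y))) ->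
  (forall x, J (ar x * ar (bnext x) * ar x)) ->
  (forall x y, y <> bnext x -> J (ar x * ar y)) ->
  forall g, IG g -> J g.
Proof.
move=> JI J1 J2 J3 g; apply=> // _ [x y xy|x|x y xy inf exc].
- by rewrite !special_cycle_powE; apply: J1.
- by rewrite special_cycle_powE; apply: J2.
- apply: J3 => yx; case: (val_mult_cases (tag x)) => [[E Em]|[E _]].
    by apply: exc; rewrite /barrow_vertex Em yx; have [_ ->] := special_cycle_loop E.
  by have := inf x; rewrite special_cycle_pair // yx /= !eqxx.
Qed.

Lemma brauer_ideal_paths_ge2 g : IG g -> paths_ge 2 g.
Proof.
apply; first exact: paths_ge_two_sided.
have ar2 x y : paths_ge 2 (ar x * ar y).
  by apply: (@paths_geM _ _ 1 1); apply: paths_ge_arrow.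
move=> _ [x y _|x|x y _ _ _]; rewrite ?special_cycle_powE //.
  by apply: paths_geD => //; apply: paths_geN.
by have [_ IMr] := @paths_ge_two_sided K QG 2; apply: IMr.
Qed.

Lemma brauer_ideal_admissible : admissible (brauer_ideal K G).
Proof.
split=> [g /brauer_ideal_paths_ge2/arrow_ideal_powP //|].
by exists 3; split=> // g /arrow_ideal_powP/brauer_ideal_paths_ge3.
Qed.

Lemma brauer_ideal_arrowM (x y : qarrow QG) :
  ~ brauer_ideal K G (arrow K x * arrow K y) -> y = bnext x /\ x = bnext y.
Proof.
move=> xy; have E : y = bnext x by apply: contrapT => /brauer_ideal_mismatch.
by split=> //; rewrite E bnextK.
Qed.

Lemma ex_barrow_src (v : bpolygon G) : exists x, bsrc x = v.
Proof.
have [a av a1] := polygon_nontruncated v.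
have : v \in tval (orientation a) by rewrite -has_pred1 has_count orientationP.
case/tnthP=> i ->.
pose na : nontruncated G := exist _ a a1.
by exists (Tagged (fun a : nontruncated G => 'I_(val_ (val a))) (i : 'I_(val_ (val na)))).
Qed.

(** Here [h] picks one arrow leaving each polygon. Modulo the ideal all special cycle powers at [v]
    agree with the one starting at [h v], so one coefficient per polygon suffices in length 2. *)
Lemma brauer_ideal_span (h : bpolygon G -> barrow G) g : (forall v, bsrc (h v) = v) ->
  exists (a : bpolygon G -> K) (b : barrow G -> K) (c : bpolygon G -> K),
  IG (g - (\sum_v a v *: path_elt K (ptriv (v : qvertex QG)) +
           \sum_x b x *: ar x + \sum_v c v *: (ar (h v) * ar (bnext (h v))))).
Proof.
have [[I0 ID IMl] IMr] := ideal_gen_two_sided (brauer_relation (K := K) (G := G)).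
move=> hP; have JI := ideal_gen_two_sided (brauer_relation (K := K) (G := G)).
have [a [b [c H]]] := path_alg_span g JI (@brauer_ideal_paths_ge3).
exists a, b, (fun v => \sum_(p | bsrc p.1 == v) if p.2 == bnext p.1 then c p else 0).
set S := \sum_v _ *: (ar (h v) * _).
suff HS : IG (\sum_p c p *: (arrow K p.1 * arrow K p.2) - S).
  by move: (ID _ _ H HS); rewrite !opprD !addrA subrK.
(* Regroup the pairs by the source of their first arrow. *)
have -> : S = \sum_p (if p.2 == bnext p.1 then c p else 0) *:
    (ar (h (bsrc p.1)) * ar (bnext (h (bsrc p.1)))).
  rewrite [RHS](partition_big (fun p => bsrc p.1) predT) //=.
  apply: eq_bigr => v _; rewrite scaler_suml.
  by apply: eq_bigr => p /eqP ->.
rewrite -sumrB; apply: (big_ind IG) => // -[x y] _ /=; case: eqP => [->|yx].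
  rewrite -scalerBr -[_ - _]mul1r scalerAl; apply: IMl.
  by apply: brauer_ideal_cycleB; rewrite hP.
rewrite scale0r subr0 -[_ * _]mul1r scalerAl; apply: IMl.
exact: brauer_ideal_mismatch.
Qed.

End TwoStepBrauerConfiguration.

Lemma sum_count_mem (T : finType) (r : seq T) :
  (\sum_(x : T) count_mem x r = size r)%N.
Proof.
elim: r => [|y r IH] /=; first by rewrite big1.
rewrite big_split IH /= (bigD1 y) //= eqxx big1 // => x /negPf.
by rewrite eq_sym => ->.
Qed.

(** * The Brauer configuration of an involution on arrows *)

Section InvolutionConfiguration.
Variables (V B : finType) (tau : B -> B) (sg : B -> V).
Hypotheses (tauK : forall b, tau (tau b) = b) (sg_surj : forall v, exists b, sg b = v).
Hypothesis V_nonempty : (0 < #|V|)%N.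

(** Each orbit of [tau] is represented by its element of least rank. *)
Definition orbit_rep : Type := {b : B | (enum_rank b <= enum_rank (tau b))%N}.
HB.instance Definition _ := SubFinite.on orbit_rep.

(** The polygons around the orbit, seen as a vertex of the configuration; a two-element orbit may
    meet the same polygon twice. *)
Definition orbit_src (b : orbit_rep) : seq V :=
  if tau (val b) == val b then [:: sg (val b)] else [:: sg (val b); sg (tau (val b))].

Definition orbit_degree (v : V) : nat := \sum_(b : orbit_rep) count_mem v (orbit_src b).

(* Truncated vertices, added so that the polygons with a single incidence become
   2-gons. *)
Definition leaf : Type := {v : V | orbit_degree v == 1%N}.
HB.instance Definition _ := SubFinite.on leaf.

Definition orbit_incidence (x : orbit_rep + leaf) : seq V :=
  match x with inl b => orbit_src b | inr v => [:: val v] end.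

Definition orbit_mult (x : orbit_rep + leaf) : nat :=
  if x is inl b then (if tau (val b) == val b then 2 else 1)%N else 1%N.

Definition orbit_polygon (v : V) : {mset (orbit_rep + leaf)%type}%mset :=
  seq_mset (flatten
    [seq nseq (count_mem v (orbit_incidence x)) x | x <- enum {: orbit_rep + leaf}]).

Lemma orbit_polygonE v x : orbit_polygon v x = count_mem v (orbit_incidence x).
Proof.
rewrite mset_seqE count_flatten -map_comp sumnE big_map big_enum /=.
rewrite (bigD1 x) //= big1 => [|y /negPf yx]; rewrite count_nseq /= ?eqxx ?mul1n ?addn0 //.
by rewrite yx.
Qed.

(** A leaf is added at [v] exactly when a single orbit incidence occurs there. *)
Lemma size_orbit_polygon v :
  size (orbit_polygon v) = (orbit_degree v + (orbit_degree v == 1))%N.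
Proof.
rewrite (perm_size (perm_eq_seq_mset _)) size_flatten /shape -map_comp sumnE big_map.
rewrite big_enum /= big_sumType /=; congr (_ + _)%N.
  by apply: eq_bigr => b _; rewrite size_nseq.
under eq_bigr do rewrite size_nseq addn0.
have [v1|v1] := boolP (orbit_degree v == 1%N).
  rewrite (bigD1 (exist _ v v1 : leaf)) //= eqxx big1 // => w wv.
  by case: eqP => // E; case/eqP: wv; apply: val_inj.
by rewrite big1 // => -[w w1] _ /=; case: eqP => // wv; rewrite -wv w1 in v1.
Qed.

Lemma orbit_valency x : valency orbit_polygon x = size (orbit_incidence x).
Proof.
by rewrite -sum_count_mem; apply: eq_bigr => v _; rewrite orbit_polygonE.
Qed.

Lemma orbit_src_size b : size (orbit_src b) = if tau (val b) == val b then 1%N else 2%N.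
Proof. by rewrite /orbit_src; case: ifP. Qed.

Lemma orbit_val_mult (b : orbit_rep) :
  (valency orbit_polygon (inl b) * orbit_mult (inl b) = 2)%N.
Proof. by rewrite orbit_valency /= orbit_src_size; case: ifP. Qed.

Lemma leaf_val_mult (v : leaf) :
  (valency orbit_polygon (inr v) * orbit_mult (inr v) = 1)%N.
Proof. by rewrite orbit_valency. Qed.

(** At most two entries have only one cyclic order, so the incidence list can be taken as it
    stands. *)
Definition orbit_orientation x : (valency orbit_polygon x).-tuple V :=
  tcast (esym (orbit_valency x)) (in_tuple (orbit_incidence x)).

Lemma orbit_orientationE x : orbit_orientation x = orbit_incidence x :> seq V.
Proof. by rewrite val_tcast. Qed.

Lemma ex_orbit_rep b : exists r : orbit_rep, b = val r \/ tau (val r) <> val r /\ b = tau (val r).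
Proof.
have [le|lt] := leqP (enum_rank b) (enum_rank (tau b)).
  by exists (exist _ b le : orbit_rep); left.
have le : (enum_rank (tau b) <= enum_rank (tau (tau b)))%N by rewrite tauK ltnW.
exists (exist _ (tau b) le : orbit_rep); right; rewrite /= tauK; split=> // E.
by rewrite -E ltnn in lt.
Qed.

Lemma orbit_rep_incident v : exists r : orbit_rep, (0 < count_mem v (orbit_src r))%N.
Proof.
have [b bv] := sg_surj v; have [r rb] := ex_orbit_rep b; exists r.
rewrite /orbit_src -bv; case: ifP => [/eqP E|_]; case: rb => [->|[ne ->]] //=;
  by rewrite eqxx ?addnS // addnC.
Qed.

Lemma orbit_degree_gt0 v : (0 < orbit_degree v)%N.
Proof.
have [r rv] := orbit_rep_incident v.
by rewrite /orbit_degree (bigD1 r) //= addn_gt0 rv.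
Qed.

(** Surjectivity of [sg] puts an orbit, hence a nontruncated vertex, into every polygon (C3); the
    leaves raise size 1 to size 2, which gives (C2) and (C4). *)
Definition orbit_configuration : brauer_configuration.
Proof.
apply: (@BrauerConfiguration (orbit_rep + leaf)%type V V_nonempty orbit_polygon
  orbit_mult orbit_orientation).
- by case=> //= b; case: ifP.
- by move=> x _ v; rewrite orbit_orientationE orbit_polygonE.
- move=> [b|v]; last by exists (val v); rewrite orbit_polygonE /= eqxx.
  exists (sg (val b)); rewrite orbit_polygonE /= /orbit_src.
  by case: ifP => _ /=; rewrite eqxx.
- move=> v; rewrite size_orbit_polygon; have := orbit_degree_gt0 v.
  by case: (orbit_degree v) => [|[|n]].
- move=> v; have [r rv] := orbit_rep_incident v.
  by exists (inl r); rewrite ?orbit_polygonE ?orbit_val_mult.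
- move=> v [b|w]; first by rewrite orbit_val_mult.
  rewrite orbit_polygonE /= addn0 size_orbit_polygon => wv _.
  have -> : v = val w by case: eqP wv.
  by have /eqP -> := valP w.
Defined.

Local Notation G := orbit_configuration.
Local Notation val_ a := (valency (@polygon G) a).

Lemma ex_nontruncated_rep (a : nontruncated G) : {r : orbit_rep | val a = inl r}.
Proof.
case: a => [[r|v] av] /=; first by exists r.
by exfalso; move: av; rewrite leaf_val_mult.
Qed.

Definition nontruncated_rep (a : nontruncated G) : orbit_rep := sval (ex_nontruncated_rep a).

Lemma nontruncated_repE a : val a = inl (nontruncated_rep a).
Proof. exact: svalP (ex_nontruncated_rep a). Qed.

Lemma orbit_configuration_val_mult (a : nontruncated G) :
  (val_ (val a) * mult (val a) = 2)%N.
Proof. by rewrite nontruncated_repE orbit_val_mult. Qed.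

Lemma nontruncated_valency (a : nontruncated G) :
  val_ (val a) = size (orbit_src (nontruncated_rep a)).
Proof. by rewrite nontruncated_repE [LHS]orbit_valency. Qed.

(* Position 0 at an orbit is its representative, position 1 (if any) the other
   element. *)
Definition barrow_orbit (x : barrow G) : B :=
  let b := val (nontruncated_rep (tag x)) in if tagged x == 0%N :> nat then b else tau b.

Lemma bsrc_orbit x : bsrc x = sg (barrow_orbit x).
Proof.
rewrite /bsrc /barrow_orbit /barrow_vertex; case: x => a i /=.
(* Any [v0] serves as the default of [nth]; the index is in range. *)
have /card_gt0P[v0 _] := V_nonempty.
rewrite (tnth_nth v0) orbit_orientationE; case: i => i ilt /=.
rewrite nontruncated_repE /=; move: ilt; rewrite nontruncated_valency /orbit_src.
by case: ifP => _; case: i => [|[|i]].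
Qed.

(** The shift swaps positions 0 and 1; with position 0 alone, [tau] fixes the representative. *)
Lemma barrow_orbit_next x : barrow_orbit (bnext x) = tau (barrow_orbit x).
Proof.
rewrite /barrow_orbit /bnext; case: x => a i /=.
case: i => i; rewrite /= nontruncated_valency /orbit_src.
by case: ifP => [/eqP E|_]; case: i => [|[|i]] //= _.
Qed.

Lemma barrow_orbit_inj : injective barrow_orbit.
Proof.
move=> [a i] [a' i']; rewrite /barrow_orbit /=.
set r := nontruncated_rep a; set r' := nontruncated_rep a' => E.
have rr : r = r'.
  apply: val_inj => /=.
  have [//|rt] : val r = val r' \/ val r = tau (val r').
    move: E; case: eqP => _; case: eqP => _ E; auto.
      by right; apply: (can_inj tauK); rewrite tauK.
    by left; apply: (can_inj tauK).
  (* Both representatives have the least rank in their common orbit. *)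
  apply: enum_rank_inj; apply/ord_inj/eqP; rewrite eqn_leq.
  have h : (enum_rank (val r) <= enum_rank (tau (val r)))%N := valP r.
  have h' : (enum_rank (val r') <= enum_rank (tau (val r')))%N := valP r'.
  by apply/andP; split; [rewrite rt tauK in h; rewrite rt | rewrite -rt in h'].
have aa : a = a' by apply: val_inj; rewrite !nontruncated_repE -/r -/r' rr.
subst a'; congr existT; apply: ord_inj; move: E.
case: i => i; case: i' => i' /=; rewrite nontruncated_valency /orbit_src -/r.
by case: eqP => tr; case: i => [|[|i]] //; case: i' => [|[|i']] //= _ _ E; case: tr.
Qed.

Lemma barrow_orbit_surj b : exists x, barrow_orbit x = b.
Proof.
have [r rb] := ex_orbit_rep b.
have ra : (1 < valency (polygon (b := G)) (inl r) * mult (inl r : bvertex G))%N.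
  by rewrite orbit_val_mult.
pose a : nontruncated G := exist _ (inl r : bvertex G) ra.
have aE : nontruncated_rep a = r by have := nontruncated_repE a => -[<-].
have av := nontruncated_valency a.
have i0 : (0 < val_ (val a))%N by rewrite av aE /orbit_src; case: ifP.
case: rb => [->|[tr ->]].
  by exists (Tagged (fun a : nontruncated G => 'I_(val_ (val a))) (Ordinal i0));
     rewrite /barrow_orbit /= aE.
have i1 : (1 < val_ (val a))%N by rewrite av aE /orbit_src; case: eqP.
by exists (Tagged (fun a : nontruncated G => 'I_(val_ (val a))) (Ordinal i1));
     rewrite /barrow_orbit /= aE.
Qed.

End InvolutionConfiguration.

(** * Symmetric algebras with radical cube zero *)

Section SymmetricRadicalCubeZero.
Variables (K : closedFieldType) (A : algType K) (V E : finType) (s t : E -> V).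
Variables (e : V -> A) (u : E -> A) (f : {scalar A}).
Hypotheses (ee : forall v w, e v * e w = if v == w then e v else 0)
  (e1 : \sum_v e v = 1) (e0 : forall v, e v <> 0)
  (eu : forall i, e (s i) * u i = u i) (ue : forall i, u i * e (t i) = u i)
  (span : forall x, exists (a : V -> K) (b : E -> K) (c : E * E -> K),
    x = \sum_v a v *: e v + \sum_i b i *: u i + \sum_p c p *: (u p.1 * u p.2))
  (cube : forall i j k, u i * u j * u k = 0)
  (indep : forall (b : E -> K) (c : E * E -> K),
    \sum_i b i *: u i = \sum_p c p *: (u p.1 * u p.2) -> forall i, b i = 0)
  (fC : forall x y, f (x * y) = f (y * x))
  (fnd : forall x, (forall y, f (x * y) = 0) -> x = 0)
  (square_neq0 : exists i j, u i * u j <> 0)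
  (indA : indecomposable A).

(** The span of the arrows, which is a complement of the squared radical in the radical rather than
    the radical itself; [rad2] is the squared radical. *)
Definition rad1 x := exists b : E -> K, x = \sum_i b i *: u i.
Definition rad2 x := exists c : E * E -> K, x = \sum_p c p *: (u p.1 * u p.2).

Lemma euE v i : e v * u i = if v == s i then u i else 0.
Proof.
by rewrite -eu mulrA ee; case: eqP => [->|]; rewrite ?eu ?mul0r.
Qed.

Lemma ueE v i : u i * e v = if t i == v then u i else 0.
Proof. by rewrite -ue -mulrA ee; case: ifP; rewrite ?ue ?mulr0. Qed.

Lemma rad1D x y : rad1 x -> rad1 y -> rad1 (x + y).
Proof.
move=> [b ->] [c ->]; exists (fun i => b i + c i).
by rewrite -big_split; apply: eq_bigr => i _; rewrite scalerDl.
Qed.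

Lemma rad1Z k x : rad1 x -> rad1 (k *: x).
Proof.
move=> [b ->]; exists (fun i => k * b i).
by rewrite scaler_sumr; apply: eq_bigr => i _; rewrite scalerA.
Qed.

Lemma rad1_gen i : rad1 (u i).
Proof.
exists (fun j => (j == i)%:R); rewrite (bigD1 i) //= eqxx scale1r big1 ?addr0 //.
by move=> j /negPf ->; rewrite scale0r.
Qed.

Lemma rad1_sum (I : finType) (F : I -> A) : (forall i, rad1 (F i)) -> rad1 (\sum_i F i).
Proof.
move=> FP; apply: (big_ind rad1) => [||//]; last exact: rad1D.
by exists (fun=> 0); rewrite big1 // => i _; rewrite scale0r.
Qed.

Lemma rad1_eM v x : rad1 x -> rad1 (e v * x).
Proof.
move=> [b ->]; exists (fun i => if v == s i then b i else 0).
rewrite mulr_sumr; apply: eq_bigr => i _.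
by rewrite -scalerAr euE; case: ifP; rewrite ?scaler0 ?scale0r.
Qed.

Lemma rad1_Me v x : rad1 x -> rad1 (x * e v).
Proof.
move=> [b ->]; exists (fun i => if t i == v then b i else 0).
rewrite mulr_suml; apply: eq_bigr => i _.
by rewrite -scalerAl ueE; case: ifP; rewrite ?scaler0 ?scale0r.
Qed.

Lemma rad2_eM v x : rad2 x -> rad2 (e v * x).
Proof.
move=> [c ->]; exists (fun p => if v == s p.1 then c p else 0).
rewrite mulr_sumr; apply: eq_bigr => p _.
by rewrite -scalerAr mulrA euE; case: ifP; rewrite ?mul0r ?scaler0 ?scale0r.
Qed.

Lemma rad2_Me v x : rad2 x -> rad2 (x * e v).
Proof.
move=> [c ->]; exists (fun p => if t p.2 == v then c p else 0).
rewrite mulr_suml; apply: eq_bigr => p _.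
by rewrite -scalerAl -mulrA ueE; case: ifP; rewrite ?mulr0 ?scaler0 ?scale0r.
Qed.

Lemma rad2Z k x : rad2 x -> rad2 (k *: x).
Proof.
move=> [c ->]; exists (fun p => k * c p).
by rewrite scaler_sumr; apply: eq_bigr => p _; rewrite scalerA.
Qed.

Lemma rad2_gen i j : rad2 (u i * u j).
Proof.
exists (fun p => (p == (i, j))%:R); rewrite (bigD1 (i, j)) //= eqxx scale1r.
by rewrite big1 ?addr0 // => p /negPf ->; rewrite scale0r.
Qed.

Lemma rad2M x y : rad1 x -> rad1 y -> rad2 (x * y).
Proof.
move=> [b ->] [c ->]; exists (fun p => b p.1 * c p.2).
rewrite mulr_suml -(pair_bigA _ (fun i j => (b i * c j) *: (u i * u j))) /=.
apply: eq_bigr => i _; rewrite mulr_sumr; apply: eq_bigr => j _.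
by rewrite -scalerAl -scalerAr scalerA.
Qed.

Lemma rad2_rad1 x y : rad2 x -> rad1 y -> x * y = 0.
Proof.
move=> [c ->] [b ->]; rewrite mulr_suml big1 // => p _.
by rewrite mulr_sumr big1 // => i _; rewrite -scalerAl -scalerAr cube !scaler0.
Qed.

Lemma rad1_rad2 x y : rad1 x -> rad2 y -> x * y = 0.
Proof.
move=> [b ->] [c ->]; rewrite mulr_suml big1 // => i _.
by rewrite mulr_sumr big1 // => p _; rewrite -scalerAl -scalerAr mulrA cube !scaler0.
Qed.

Lemma form_eq0 x : (forall v, f (x * e v) = 0) -> (forall i, f (x * u i) = 0) ->
  (forall i j, f (x * (u i * u j)) = 0) -> x = 0.
Proof.
move=> xe xu xuu; apply: fnd => y; have [a [b [c ->]]] := span y.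
rewrite !mulrDr !linearD /= !mulr_sumr !linear_sum !big1 ?addr0 // => i _;
  by rewrite -scalerAr linearZ /= ?xe ?xu ?xuu mulr0.
Qed.

(** By symmetry of [f], an element running from [v] to [w] pairs to 0 with all vertex idempotents
    unless [v = w], and then only [f x] has to be tested. *)
Lemma corner_eq0 v w x : e v * x = x -> x * e w = x -> (v = w -> f x = 0) ->
  (forall i, f (x * u i) = 0) -> (forall i j, f (x * (u i * u j)) = 0) -> x = 0.
Proof.
move=> vx xw fx xu xuu; apply: form_eq0 => // w'.
have -> : f (x * e w') = f (x * (e w' * e v)) by rewrite -{1}vx -mulrA fC mulrA.
rewrite ee; case: eqP => [->|_]; last by rewrite mulr0 linear0.
rewrite -xw -mulrA ee; case: eqP => [E'|_]; last by rewrite mulr0 linear0.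
by rewrite xw fx.
Qed.

(* Otherwise the form kills the ideal generated by any arrow joining [v] to another
   vertex, so there is none and [e v] is central, hence equal to 1. *)
Lemma vertex_square v : exists i j, e v * (u i * u j) <> 0.
Proof.
apply: contrapT => /forallNP vuu.
have {}vuu i j : e v * (u i * u j) = 0 by apply: contrapT => H; apply: (vuu i); exists j.
(* Rotating under [f] makes any nonzero product of [u i] with an arrow begin at [v], where products
   of two arrows vanish. *)
have u0 i : s i = v \/ t i = v -> s i <> t i -> u i = 0.
  move=> vi st; apply: (@corner_eq0 (s i) (t i)) => // [j|j k]; last first.
    by rewrite mulrA cube linear0.
  case: vi => vi; first by rewrite -eu vi -mulrA vuu linear0.
  have [vj|vj] := eqVneq v (s j).
    by rewrite fC -eu -vj -mulrA vuu linear0.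
  by rewrite -ue -mulrA vi euE (negPf vj) mulr0 linear0.
have vC x : e v * x = x * e v.
  have vu i : e v * u i = u i * e v.
    rewrite euE ueE [v == _]eq_sym; case: eqP => si; case: eqP => ti //.
      by apply: u0; [left | rewrite si => /esym].
    by apply/esym/u0; [right | rewrite ti].
  have [a [b [c ->]]] := span x.
  rewrite !mulrDr !mulrDl !mulr_sumr !mulr_suml.
  congr (_ + _ + _); apply: eq_bigr => i _; rewrite -scalerAr -scalerAl //.
  - by rewrite !ee eq_sym; case: eqP => // ->.
  - by rewrite vu.
  - by rewrite mulrA vu -!mulrA vu.
have vv : e v * e v = e v by rewrite ee eqxx.
case: (indecomposable_central_idempotent indA vC vv) => [/e0 //|v1].
by have [i [j]] := square_neq0; rewrite -[u i * _]mul1r -v1 vuu.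
Qed.

(** A nonzero element of the squared radical starting at [v] is killed by all arrows, so
    nondegeneracy makes it pair nontrivially with [e v]; then rescale. *)
Lemma ex_socle v : exists z, [/\ rad2 z, e v * z = z, z * e v = z & f z = 1].
Proof.
have [i [j]] := vertex_square v; set y := e v * _ => y0.
have ry : rad2 y by apply/rad2_eM/rad2_gen.
have vy : e v * y = y by rewrite /y mulrA ee eqxx.
clearbody y.
have fy : f (y * e v) <> 0.
  move=> fy; apply: y0; apply: form_eq0 => [w|k|k l]; last 2 first.
  - by rewrite (rad2_rad1 ry (rad1_gen k)) linear0.
  - by rewrite mulrA (rad2_rad1 ry (rad1_gen k)) mul0r linear0.
  rewrite -vy -mulrA fC -mulrA ee; case: eqP => [->|_] //.
  by rewrite mulr0 linear0.
exists ((f (y * e v))^-1 *: (y * e v)); split.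
- exact/rad2Z/rad2_Me.
- by rewrite -scalerAr mulrA vy.
- by rewrite -scalerAl -[y * e v * e v]mulrA ee eqxx.
- by rewrite linearZ /= mulVf //; apply/eqP.
Qed.

(** The difference [y - f y *: z] is killed by all arrows. For [v = w] it also lies in the kernel of
    [f]; for distinct vertices [f y = 0]. Hence [corner_eq0] applies. *)
Lemma rad2_socle v w y z : rad2 z -> e v * z = z -> z * e v = z -> f z = 1 ->
  rad2 y -> e v * y = y -> y * e w = y -> y = f y *: z.
Proof.
move=> rz vz zv fz ry vy yw; have nz x : rad2 x -> forall i, x * u i = 0.
  by move=> rx i; apply: rad2_rad1 => //; apply: rad1_gen.
have yzu i : (y - f y *: z) * u i = 0 by rewrite mulrBl -scalerAl !nz // scaler0 subr0.
apply/eqP; rewrite -subr_eq0; apply/eqP.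
have [E'|ne] := eqVneq v w.
  apply: (@corner_eq0 v v).
  - by rewrite mulrBr vy -scalerAr vz.
  - by rewrite mulrBl -scalerAl zv E' yw.
  - by rewrite linearB linearZ /= fz mulr1 subrr.
  - by move=> i; rewrite yzu linear0.
  - by move=> i j; rewrite mulrA yzu mul0r linear0.
have -> : f y = 0 by rewrite -yw fC -vy mulrA ee eq_sym (negPf ne) mul0r linear0.
rewrite scale0r subr0; apply: (@corner_eq0 v w) => // [E'|i|i j].
- by rewrite E' eqxx in ne.
- by rewrite (nz y ry) linear0.
- by rewrite mulrA (nz y ry) mul0r linear0.
Qed.

(** Only [v = w] needs an argument: there [x = f x *: z] with [z] in the squared radical, which
    meets the span of the arrows in 0. *)
Lemma rad1_nondeg v w x : rad1 x -> e v * x = x -> x * e w = x ->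
  (forall i, f (x * u i) = 0) -> x = 0.
Proof.
move=> rx vx xw xu.
have xuu i j : x * (u i * u j) = 0 by apply: rad1_rad2 => //; apply: rad2_gen.
have [E'|/eqP ne] := eqVneq v w; last first.
  by apply: (corner_eq0 vx xw) => // i j; rewrite xuu linear0.
have [z [rz vz zv fz]] := ex_socle v.
suff xz : x = f x *: z.
  have [c zE] := rad2Z (f x) rz; rewrite -xz in zE; have [b bE] := rx.
  rewrite bE in zE; have b0 := indep zE.
  by rewrite bE big1 // => i _; rewrite b0 scale0r.
have zu i : z * u i = 0 by apply: rad2_rad1 => //; apply: rad1_gen.
apply/eqP; rewrite -subr_eq0; apply/eqP; apply: (@corner_eq0 v v).
- by rewrite mulrBr vx -scalerAr vz.
- by rewrite mulrBl -scalerAl zv E' xw.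
- by rewrite linearB linearZ /= fz mulr1 subrr.
- by move=> i; rewrite mulrBl -scalerAl zu scaler0 subr0.
- by move=> i j; rewrite mulrBl xuu mulrA -scalerAl zu scaler0 mul0r subrr linear0.
Qed.

(* [sg b] is the source of [phi b] and [tau] matches each [phi b] with its dual
   vector; [phi] need not span. *)
Definition frame (B : finType) (tau : B -> B) (sg : B -> V) (phi : B -> A) : Prop :=
  [/\ forall b, tau (tau b) = b, forall b, rad1 (phi b),
      forall b, e (sg b) * phi b = phi b, forall b, phi b * e (sg (tau b)) = phi b
    & forall b b', f (phi b * phi b') = (b' == tau b)%:R].

(** The component of [x] orthogonal to the frame; the coefficient at [phi b] is read off by its dual
    [phi (tau b)]. *)
Definition residue (B : finType) (tau : B -> B) (phi : B -> A) (x : A) : A :=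
  x - \sum_b f (x * phi (tau b)) *: phi b.

Lemma frame_sum (B C : finType) tauB sgB phiB tauC sgC phiC :
  @frame B tauB sgB phiB -> @frame C tauC sgC phiC ->
  (forall b c, f (phiB b * phiC c) = 0) ->
  @frame (B + C)%type
    (fun x => match x with inl b => inl (tauB b) | inr c => inr (tauC c) end)
    (fun x => match x with inl b => sgB b | inr c => sgC c end)
    (fun x => match x with inl b => phiB b | inr c => phiC c end).
Proof.
move=> [B1 B2 B3 B4 B5] [C1 C2 C3 C4 C5] BC.
split=> [[b|c]|[b|c]|[b|c]|[b|c]|[b|c] [b'|c']] //.
- by rewrite B1.
- by rewrite C1.
- by rewrite fC BC.
Qed.

Lemma rad1_residue (B : finType) tau sg phi x :
  @frame B tau sg phi -> rad1 x -> rad1 (residue tau phi x).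
Proof.
move=> [_ rphi _ _ _] rx; apply: rad1D => //; rewrite -scaleN1r; apply: rad1Z.
by apply: rad1_sum => b; apply: rad1Z.
Qed.

Lemma residue_orth (B : finType) tau sg phi x b :
  @frame B tau sg phi -> f (residue tau phi x * phi b) = 0.
Proof.
move=> [tauK _ _ _ phiM]; rewrite mulrBl linearB mulr_suml linear_sum /=.
rewrite (bigD1 (tau b)) //= big1 => [|c cb].
  by rewrite -scalerAl linearZ /= phiM !tauK eqxx mulr1 addr0 subrr.
rewrite -scalerAl linearZ /= phiM; case: eqP => [bc|]; last by rewrite mulr0.
by rewrite bc tauK eqxx in cb.
Qed.

Lemma corner_orth v w x y : f (e v * x * e w * y) = f (x * (e w * y * e v)).
Proof. by rewrite -2!mulrA fC !mulrA. Qed.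

(** Moved across the form, the idempotents turn [phi b] into itself or 0. *)
Lemma frame_corner_orth (B : finType) tau sg phi x v w :
  @frame B tau sg phi -> (forall b, f (x * phi b) = 0) ->
  forall b, f (e v * x * e w * phi b) = 0.
Proof.
move=> [_ _ ephi phie _] xphi b; rewrite corner_orth.
have -> : e w * phi b = if w == sg b then phi b else 0.
  by rewrite -ephi mulrA ee; case: eqP => [->|_]; rewrite ?ephi ?mul0r.
case: ifP => _; last by rewrite mul0r mulr0 linear0.
rewrite -[phi b]phie -mulrA ee; case: ifP => _; last by rewrite !mulr0 linear0.
by rewrite phie xphi.
Qed.

Lemma frame_loop v x : rad1 x -> e v * x = x -> x * e v = x -> f (x * x) = 1 ->
  @frame unit id (fun=> v) (fun=> x).
Proof. by move=> rx vx xv fx; split=> // [[] []]; rewrite fx. Qed.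

Lemma frame_pair v w x y : rad1 x -> e v * x = x -> x * e w = x ->
  rad1 y -> e w * y = y -> y * e v = y ->
  f (x * x) = 0 -> f (y * y) = 0 -> f (x * y) = 1 ->
  @frame bool negb (fun b => if b then v else w) (fun b => if b then x else y).
Proof.
move=> rx vx xw ry wy yv fx fy fxy; split=> [b|[]|[]|[]|[] []] //=.
- exact: negbK.
- by rewrite fC.
Qed.

(** The pairing matrix of the frame with its dual is the identity and factors through a space of
    dimension [#|E|]. *)
Lemma frame_card (B : finType) tau sg phi : @frame B tau sg phi -> (#|B| <= #|E|)%N.
Proof.
move=> [tauK /choice[c cE] _ _ phiM].
pose C : 'M[K]_(#|B|, #|E|) := \matrix_(i, k) c (enum_val i) (enum_val k).
pose D : 'M[K]_(#|E|, #|B|) :=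
  \matrix_(k, j) f (u (enum_val k) * phi (tau (enum_val j))).
have CD : C *m D = 1%:M.
  apply/matrixP => i j; rewrite !mxE.
  transitivity (f (phi (enum_val i) * phi (tau (enum_val j)))).
    rewrite [in RHS]cE mulr_suml linear_sum [RHS](reindex _ (onW_bij _ (@enum_val_bij E))).
    by apply: eq_bigr => k _; rewrite !mxE -scalerAl linearZ.
  rewrite phiM (can_eq tauK) (inj_eq enum_val_inj) eq_sym; by case: eqP.
rewrite -(mxrank1 K #|B|) -CD.
exact: leq_trans (mxrankM_maxl _ _) (rank_leq_col _).
Qed.

(** Algebraic closure enters here, to normalize a vector with [f (y * y) <> 0]. *)
Lemma ex_sqrt (k : K) : exists r, r * r = k.
Proof.
have [r rE] := @solve_monicpoly K 2%N (fun i => if i == 0%N then k else 0) isT.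
exists r; move: rE; rewrite !big_ord_recl big_ord0 expr2 /= => ->.
by rewrite expr0 mulr1 mul0r !addr0.
Qed.

(* In the orthogonal complement of the frame, split off a normalized anisotropic
   homogeneous vector if there is one.  If every homogeneous vector is isotropic,
   any dual pair is hyperbolic; no division by 2 is needed. *)
Lemma frame_extend (B : finType) tau sg phi x :
  @frame B tau sg phi -> rad1 x -> residue tau phi x <> 0 ->
  exists (B' : finType) tau' sg' phi', @frame B' tau' sg' phi' /\ (#|B| < #|B'|)%N.
Proof.
move=> fB rx; move: (rad1_residue fB rx) (fun b => residue_orth x b fB).
move: (residue _ _ _) => r rr ro r0.
have [v [w vrw]] : exists v w, e v * r * e w <> 0.
  apply: contrapT => /forallNP H; apply: r0.
  rewrite -[r]mul1r -[1 * r]mulr1 -e1 mulr_suml mulr_suml big1 // => v _.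
  rewrite mulr_sumr big1 // => w _; apply: contrapT => vw.
  by apply: (H v); exists w.
pose hom v w y := [/\ rad1 y, e v * y = y, y * e w = y & forall b, f (y * phi b) = 0].
have hom_corner v' w' y : rad1 y -> (forall b, f (y * phi b) = 0) ->
    hom v' w' (e v' * y * e w').
  move=> ry oy; split.
  - exact/rad1_Me/rad1_eM.
  - by rewrite !mulrA ee eqxx.
  - by rewrite -[e v' * y * e w' * e w']mulrA ee eqxx.
  - exact: frame_corner_orth fB oy.
have := hom_corner v w r rr ro; move: (e v * r * e w) vrw => {rr ro r0}r r0 hr.
have [[v' [w' [y [[ry vy yw oy] yy]]]]|iso] :=
    pselect (exists v w y, hom v w y /\ f (y * y) <> 0).
  (* An anisotropic vector is a loop, since otherwise its square vanishes. *)
  have vw : w' = v'.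
    apply: contrapT => /eqP vw; apply: yy.
    by rewrite -{1}yw -vy -mulrA [e w' * _]mulrA ee (negPf vw) mul0r mulr0 linear0.
  rewrite vw in yw; have [k kk] := ex_sqrt (f (y * y))^-1.
  have fl : @frame unit id (fun=> v') (fun=> k *: y).
    apply: frame_loop.
    - exact: rad1Z.
    - by rewrite -scalerAr vy.
    - by rewrite -scalerAl yw.
    - rewrite -scalerAl -scalerAr !linearZ /= mulrA kk mulVf //; exact/eqP.
  have BC b c : f (phi b * (fun=> k *: y) (c : unit)) = 0.
    by rewrite -scalerAr linearZ /= fC oy mulr0.
  exists (B + unit)%type; do 3!eexists; split; first exact: frame_sum fB fl BC.
  by rewrite card_sum card_unit addn1.
have {}iso v' w' y : hom v' w' y -> f (y * y) = 0.
  by move=> hy; apply: contrapT => yy; apply: iso; exists v', w', y.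
have [rr vr rw ro] := hr.
have [i ri] : exists i, f (r * u i) <> 0.
  apply: contrapT => /forallNP H; apply: r0; apply: (rad1_nondeg rr vr rw) => i.
  by apply: contrapT.
(* Projecting the arrow off the frame keeps its pairing with [r], which is orthogonal to the frame;
   so does passing to the corner from [w] to [v]. *)
pose y0 := residue tau phi ((f (r * u i))^-1 *: u i).
have ry0 : rad1 y0 by apply: rad1_residue fB _; apply/rad1Z/rad1_gen.
have hy := hom_corner w v y0 ry0 (fun b => residue_orth _ b fB).
have fry0 : f (r * y0) = 1.
  rewrite mulrBr linearB /= mulr_sumr linear_sum big1 => [|b _]; last first.
    by rewrite -scalerAr linearZ /= ro mulr0.
  by rewrite subr0 -scalerAr linearZ /= mulVf //; apply/eqP.
have fry : f (r * (e w * y0 * e v)) = 1.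
  by rewrite fC corner_orth vr rw fC.
move: (e w * y0 * e v) hy fry => y hy fry; have [ry wy yv oy] := hy.
have fp := frame_pair rr vr rw ry wy yv (iso _ _ _ hr) (iso _ _ _ hy) fry.
exists (B + bool)%type; do 3!eexists; split; first apply: frame_sum fB fp _.
  by move=> b []; rewrite fC ?ro ?oy.
by rewrite card_sum card_bool addn2.
Qed.

(** Otherwise every frame could be enlarged, starting from the empty one, against the bound of
    [frame_card]. *)
Lemma ex_complete_frame : exists (B : finType) tau sg phi,
  @frame B tau sg phi /\ forall x, rad1 x -> x = \sum_b f (x * phi (tau b)) *: phi b.
Proof.
apply: contrapT => nc.
have big n : exists (B : finType) tau sg phi, @frame B tau sg phi /\ (n <= #|B|)%N.
  elim: n => [|n [B [tau [sg [phi [fB nB]]]]]].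
    exists void, id, (@of_void V), (@of_void A).
    by split=> //; split; case.
  have [x [rx xr]] : exists x, rad1 x /\ residue tau phi x <> 0.
    apply: contrapT => /forallNP H; apply: nc; exists B, tau, sg, phi; split=> // x rx.
    apply/eqP; rewrite -subr_eq0; apply/eqP; apply: contrapT => xr.
    by apply: (H x).
  have [B' [tau' [sg' [phi' [fB' BB']]]]] := frame_extend fB rx xr.
  by exists B', tau', sg', phi'; split=> //; apply: leq_ltn_trans BB'.
have [B [tau [sg [phi [fB]]]]] := big #|E|.+1.
by rewrite ltnNge (frame_card fB).
Qed.

(** The product lies in the squared radical and starts at [sg b], so it is the multiple of
    [z (sg b)] given by its value under [f]. *)
Lemma frame_mul (B : finType) tau sg phi (z : V -> A) b b' :
  @frame B tau sg phi ->
  (forall v, [/\ rad2 (z v), e v * z v = z v, z v * e v = z v & f (z v) = 1]) ->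
  phi b * phi b' = if b' == tau b then z (sg b) else 0.
Proof.
move=> [tauK rphi ephi phie phiM] zP; have [rz vz zv fz] := zP (sg b).
have rb : rad2 (phi b * phi b') by apply: rad2M.
have eb : e (sg b) * (phi b * phi b') = phi b * phi b' by rewrite mulrA ephi.
have be : (phi b * phi b') * e (sg (tau b')) = phi b * phi b' by rewrite -mulrA phie.
rewrite [LHS](rad2_socle rz vz zv fz rb eb be) phiM.
by case: ifP; rewrite ?scale1r ?scale0r.
Qed.

(** Otherwise [e v] would kill all arrows, contrary to [vertex_square]. *)
Lemma frame_src_surj (B : finType) tau sg phi v :
  @frame B tau sg phi -> (forall x, rad1 x -> x = \sum_b f (x * phi (tau b)) *: phi b) ->
  exists b, sg b = v.
Proof.
move=> [_ _ ephi _ _] complete; apply: contrapT => /forallNP nv.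
have [i [j]] := vertex_square v; apply.
rewrite mulrA [u i]complete; last exact: rad1_gen.
rewrite mulr_sumr big1 ?mul0r // => b _; rewrite -scalerAr.
suff -> : e v * phi b = 0 by rewrite scaler0.
by rewrite -ephi mulrA ee; case: eqP => [/esym/nv //|_]; rewrite mul0r.
Qed.

(** Arrows of the Brauer quiver go to frame vectors. The relations hold by [frame_mul]; the kernel
    is no larger because [f] detects every coefficient of the reduced form of
    [brauer_ideal_span]. *)
Lemma symmetric_cube_zero_brauer : (0 < #|V|)%N ->
  exists2 G : brauer_configuration,
    (forall a : nontruncated G, valency (@polygon G) (val a) * mult (val a) = 2)%N
    & alg_isomorphic A (brauer_configuration_algebra K G).
Proof.
move=> V0; have [B [tau [sg [phi [fB complete]]]]] := ex_complete_frame.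
have [z zP] := choice ex_socle.
have sg_surj v : exists b, sg b = v by apply: frame_src_surj fB complete.
have [tauK rphi ephi phie phiM] := fB.
exists (orbit_configuration tauK sg_surj V0); first exact: orbit_configuration_val_mult.
have v2 := @orbit_configuration_val_mult _ _ _ _ tauK sg_surj V0.
(* From here on only a bijection [g] from the arrows to the frame, compatible with sources and
   successors, is remembered. *)
move: (@bsrc_orbit _ _ _ _ tauK sg_surj V0) (@barrow_orbit_next _ _ _ _ tauK sg_surj V0)
  (@barrow_orbit_inj _ _ _ _ tauK sg_surj V0) (@barrow_orbit_surj _ _ _ _ tauK sg_surj V0).
move: (@barrow_orbit _ _ _ _ tauK sg_surj V0).
set G := orbit_configuration tauK sg_surj V0 in v2 * => g gs gn ginj gsurj.
pose w (x : barrow G) := phi (g x).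
have radw x : rad1 (w x) by apply: rphi.
have wM (x y : barrow G) : w x * w y = if y == bnext x then z (bsrc x) else 0.
  by rewrite /w (frame_mul _ _ fB zP) -gn (inj_eq ginj) gs.
have fw x y : f (w x * w y) = (y == bnext x)%:R by rewrite phiM -gn (inj_eq ginj).
have ew (x : barrow G) : e (bsrc x) * w x = w x by rewrite gs ephi.
have we (x : barrow G) : w x * e (btgt x) = w x by rewrite -[btgt x]/(bsrc (bnext x)) gs gn phie.
pose F := @path_lift_morphism K (brauer_quiver G) A e w ee e1 we.
have Fv v : F (path_elt K (ptriv (v : qvertex (brauer_quiver G)))) = e v.
  exact: path_lift_morphism_triv.
have Fw x : F (arrow K (x : qarrow (brauer_quiver G))) = w x.
  exact: path_lift_morphism_arrow.
clearbody F; apply: (first_isomorphism (F := F)) => [x|r].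
  have Fu i : exists r, F r = u i.
    rewrite [u i]complete; last exact: rad1_gen.
    have /choice[h hE] : forall b, exists r, F r = phi b.
      by move=> b; have [y <-] := gsurj b; exists (arrow K (y : qarrow (brauer_quiver G))).
    exists (\sum_b f (u i * phi (tau b)) *: h b).
    by rewrite linear_sum; apply: eq_bigr => b _; rewrite linearZ /= hE.
  have /choice[h hE] := Fu; have [a [b [c ->]]] := span x.
  exists (\sum_v a v *: path_elt K (ptriv (v : qvertex (brauer_quiver G)))
          + \sum_i b i *: h i + \sum_p c p *: (h p.1 * h p.2)).
  rewrite !linearD !linear_sum /=; congr (_ + _ + _); apply: eq_bigr => i _;
    by rewrite linearZ /= ?Fv ?rmorphM /= ?hE.
have FI q : brauer_ideal K G q -> F q = 0.
  apply: (brauer_ideal_min v2 (J := fun r => F r = 0)).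
  - split=> [|q1 a Fq]; last by rewrite rmorphM /= Fq mul0r.
    split=> [|q1 q' Fq Fq'|a q1 Fq]; first exact: rmorph0.
      by rewrite rmorphD /= Fq Fq' addr0.
    by rewrite rmorphM /= Fq mulr0.
  - by move=> x y xy; rewrite rmorphB !rmorphM /= !Fw !wM !eqxx xy subrr.
  - move=> x; rewrite !rmorphM /= !Fw wM eqxx.
    by have [rz _ _ _] := zP (bsrc x); apply: rad2_rad1.
  - by move=> x y /eqP/negPf yx; rewrite rmorphM /= !Fw wM yx.
split=> [Fr|]; last exact: FI.
have [h hE] := choice (ex_barrow_src (G := G)).
have [a [b [c H]]] := brauer_ideal_span v2 r hE.
have := FI _ H; rewrite linearB /= Fr sub0r => /eqP; rewrite oppr_eq0 => /eqP.
have -> : F (\sum_v a v *: path_elt K (ptriv (v : qvertex (brauer_quiver G))) +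
   \sum_x b x *: arrow K (x : qarrow (brauer_quiver G)) +
   \sum_v c v *: (arrow K (h v : qarrow (brauer_quiver G)) *
                  arrow K (bnext (h v) : qarrow (brauer_quiver G)))) =
   \sum_v a v *: e v + \sum_x b x *: w x + \sum_v c v *: z v.
  rewrite !linearD !linear_sum /=; congr (_ + _ + _); apply: eq_bigr => i _;
    by rewrite linearZ /= ?Fv ?Fw ?rmorphM /= ?Fw ?wM ?eqxx ?hE.
move=> S0.
have wz x v : w x * z v = 0 by have [rz _ _ _] := zP v; apply: rad1_rad2.
have zw x v : z v * w x = 0 by have [rz _ _ _] := zP v; apply: rad2_rad1.
have zz v v' : z v * z v' = 0.
  by have [[d ->] _ _ _] := zP v; rewrite mulr_suml big1 // => p _;
     have [rz _ _ _] := zP v'; rewrite -scalerAl -mulrA (rad1_rad2 _ rz) ?mulr0 ?scaler0 //;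
     apply: rad1_gen.
have sumf (I : finType) (d : I -> K) (y : I -> A) y' :
    f ((\sum_i d i *: y i) * y') = \sum_i d i * f (y i * y').
  by rewrite mulr_suml linear_sum; apply: eq_bigr => i _; rewrite -scalerAl linearZ.
have pick (I : finType) (d : I -> K) (y : I -> A) y' i0 :
    (forall i, f (y i * y') = (i == i0)%:R) -> f ((\sum_i d i *: y i) * y') = d i0.
  move=> yi; rewrite sumf (bigD1 i0) //= big1 => [|i /negPf ii].
    by rewrite yi eqxx mulr1 addr0.
  by rewrite yi ii mulr0.
have none (I : finType) (d : I -> K) (y : I -> A) y' :
    (forall i, y i * y' = 0) -> f ((\sum_i d i *: y i) * y') = 0.
  by move=> yi; rewrite sumf big1 // => i _; rewrite yi linear0 mulr0.
(* The order of the three tests matters: [z v] kills arrows and socle, [w (bnext x)] kills the socle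
   only, and [e v] may pair nontrivially with loops. *)
have a0 v : a v = 0.
  have [_ vz _ fz] := zP v.
  have := congr1 (fun y => f (y * z v)) S0; rewrite mul0r linear0 !mulrDl !linearD /=.
  rewrite (pick _ _ _ _ v) ?none ?addr0 // => v'.
  by rewrite -vz mulrA ee; case: eqP => [->|_]; rewrite ?vz ?fz ?mul0r ?linear0.
have sa : \sum_v a v *: e v = 0 by rewrite big1 // => v _; rewrite a0 scale0r.
rewrite sa add0r in S0.
have b0 x : b x = 0.
  have := congr1 (fun y => f (y * w (bnext x))) S0.
  rewrite mul0r linear0 mulrDl linearD /= (pick _ _ _ _ x) ?none ?addr0 // => y.
  by rewrite fw (can_eq (bnextK v2)) eq_sym.
have sb : \sum_x b x *: w x = 0 by rewrite big1 // => x _; rewrite b0 scale0r.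
rewrite sb add0r in S0.
have c0 v : c v = 0.
  have := congr1 (fun y => f (y * e v)) S0.
  rewrite mul0r linear0 (pick _ _ _ _ v) // => v'; have [_ _ zv fz] := zP v'.
  by rewrite -zv -mulrA ee; case: eqP => [_|_]; rewrite ?zv ?fz ?mulr0 ?linear0.
move: H; rewrite !big1 ?addr0 ?subr0 // => i _.
- by rewrite c0 scale0r.
- by rewrite b0 scale0r.
- by rewrite a0 scale0r.
Qed.

End SymmetricRadicalCubeZero.

(** By symmetry the radical of the form is a two-sided ideal, and it lies in the kernel of [f]. *)
Lemma symmetric_nondegenerate (K : fieldType) (A : algType K) (f : {scalar A}) :
  (forall x y, f (x * y) = f (y * x)) ->
  (forall J : A -> Prop, two_sided_ideal J ->
    (forall x, J x -> f x = 0) -> forall x, J x -> x = 0) ->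
  forall x, (forall y, f (x * y) = 0) -> x = 0.
Proof.
move=> fC fI; apply: fI => [|x fx]; last by rewrite -[x]mulr1.
split=> [|x a fx y]; last by rewrite -mulrA.
split=> [y|x y fx fy z|a x fx y]; first by rewrite mul0r linear0.
  by rewrite mulrDl linearD /= fx fy addr0.
by rewrite -mulrA fC -mulrA.
Qed.

Lemma ideal_mul_elt (R : nzRingType) (I J : R -> Prop) x y :
  I x -> J y -> ideal_mul I J (x * y).
Proof.
by move=> Ix Jy; exists 1%N, (fun=> x), (fun=> y); rewrite big_ord1.
Qed.

(** * Quotients by admissible ideals *)

Section AdmissibleQuotient.
Variables (K : fieldType) (Q : quiver) (I : proper_two_sided_ideal (path_alg K Q)).
Hypothesis admI : admissible I.
Local Notation A := (quot_alg I).
Local Notation q := (quot_map I).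
Local Notation ev v := (q (path_elt K (ptriv v))).
Local Notation ua i := (q (arrow K i)).

Lemma admissible_paths_ge2 g : I g -> paths_ge 2 g.
Proof. by move=> Ig; apply/arrow_ideal_powP; apply: (proj1 admI). Qed.

Lemma quot_vertexM v w : ev v * ev w = if v == w then ev v else 0.
Proof.
rewrite -rmorphM path_mulE /path_elt_mul; case: eqP => [<-|vw].
  have /eqP -> // : pcat (ptriv v) (ptriv v) == Some (ptriv v) by rewrite pcatE !eqxx.
by case E: pcat => [r|]; rewrite ?rmorph0 //; have [] := pcat_some E.
Qed.

Lemma quot_vertex_sum : \sum_v ev v = 1.
Proof. by rewrite -linear_sum -(rmorph1 q). Qed.

Lemma quot_map_ptriv g h v : q g = q h -> g@_(ptriv v) = h@_(ptriv v).
Proof.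
move=> /quot_map_eqP/admissible_paths_ge2/(_ (ptriv v) isT).
by rewrite mcoeffB => /subr0_eq.
Qed.

Lemma quot_vertex_neq0 v : ev v <> 0.
Proof.
rewrite -(rmorph0 q) => /(quot_map_ptriv v).
by rewrite mcoeff_path_elt eqxx mcoeff0 => /eqP; rewrite oner_eq0.
Qed.

Lemma quot_src_arrow i : ev (qsrc i) * ua i = ua i.
Proof.
rewrite -rmorphM path_mulE /path_elt_mul.
by have /eqP -> : pcat (ptriv (qsrc i)) (parrow i) == Some (parrow i) by rewrite pcatE !eqxx.
Qed.

Lemma quot_arrow_tgt i : ua i * ev (qtgt i) = ua i.
Proof.
rewrite -rmorphM path_mulE /path_elt_mul.
by have /eqP -> : pcat (parrow i) (ptriv (qtgt i)) == Some (parrow i) by rewrite pcatE !eqxx.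
Qed.

(** Neither [I] nor a product of two arrows has a coefficient at a single arrow. *)
Lemma quot_arrow_indep (b : qarrow Q -> K) (c : qarrow Q * qarrow Q -> K) :
  \sum_i b i *: ua i = \sum_ij c ij *: (ua ij.1 * ua ij.2) -> forall i, b i = 0.
Proof.
move=> E i; set S := \sum_i b i *: arrow K i.
set T := \sum_ij c ij *: (arrow K ij.1 * arrow K ij.2).
have : q S = q T.
  rewrite !linear_sum /= (eq_bigr (fun i => b i *: ua i)) => [|j _]; last exact: linearZ.
  by rewrite E; apply: eq_bigr => ij _; rewrite linearZ /= rmorphM.
move=> /quot_map_eqP/admissible_paths_ge2/(_ (parrow i) isT)/eqP.
rewrite mcoeffB subr_eq0 => /eqP; have -> : T@_(parrow i) = 0.
  rewrite /T raddf_sum big1 //= => ij _; rewrite mcoeffZ.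
  have := @paths_geM _ _ 1 1 _ _ (@paths_ge_arrow K _ ij.1) (@paths_ge_arrow K _ ij.2).
  by move/(_ (parrow i) isT) ->; rewrite mulr0.
rewrite /S raddf_sum (bigD1 i) //= mcoeffZ mcoeff_arrow eqxx mulr1 big1 ?addr0 //.
by move=> j /negPf ji; rewrite mcoeffZ mcoeff_arrow ji mulr0.
Qed.

Lemma quot_span : (forall i j k, ua i * ua j * ua k = 0) ->
  forall x : A, exists (a : qvertex Q -> K) (b : qarrow Q -> K)
    (c : qarrow Q * qarrow Q -> K),
  x = \sum_v a v *: ev v + \sum_i b i *: ua i + \sum_ij c ij *: (ua ij.1 * ua ij.2).
Proof.
move=> cube x; have [g ->] := quot_map_surj x.
have [|a [b [c /quot_map_eqP ->]]] := path_alg_span g (pideal_two_sided I).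
  apply: paths_ge_sub; first exact: pideal_two_sided.
  case=> [|i [|j [|k [|]]]] // _; rewrite !big_cons big_nil mulr1 mulrA.
  by apply/quot_map_eq0; rewrite !rmorphM /= cube.
exists a, b, c; rewrite !linearD !linear_sum /=.
by congr (_ + _ + _); apply: eq_bigr => i _; rewrite linearZ /= ?rmorphM.
Qed.

(** The image of the arrow ideal is nilpotent, since [I] contains one of its powers. *)
Lemma jacobson_quot_arrow i : jacobson_radical A (ua i).
Proof.
have [m [_ Im]] := proj2 admI.
pose N (x : A) := exists2 g, paths_ge 1 g & x = q g.
apply: (@nilpotent_sub_jacobson _ N m) => [|x [g g1 ->]|].
- have [[N0 ND NMl] NMr] := @paths_ge_two_sided K Q 1.
  split=> [|x a [g g1 ->]]; last first.
    by have [h ->] := quot_map_surj a; exists (g * h); [apply: NMr | rewrite rmorphM].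
  split=> [|x y [g g1 ->] [h h1 ->]|a x [g g1 ->]].
  + by exists 0; rewrite ?rmorph0.
  + by exists (g + h); [apply: ND | rewrite rmorphD].
  + by have [h ->] := quot_map_surj a; exists (h * g); [apply: NMl | rewrite rmorphM].
- rewrite -rmorphXn; apply/quot_map_eq0/Im/arrow_ideal_powP.
  elim: m {Im} => [|m IH]; first by rewrite expr0.
  by rewrite exprS -[m.+1]add1n; apply: paths_geM.
- by exists (arrow K i) => //; apply: paths_ge_arrow.
Qed.

(** The kernel of the character reading the coefficient at the trivial path; an element outside it
    has an invertible value there. *)
Lemma vertex_maximal_left_ideal v :
  maximal_left_ideal (fun x : A => exists2 g, g@_(ptriv v) = 0 & x = q g).
Proof.
split=> [||L [L0 LD LM] L1 ML x Lx].
- split=> [|x y [g g1 ->] [h h1 ->]|a x [g g1 ->]].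
  + by exists 0; rewrite ?rmorph0 ?mcoeff0.
  + by exists (g + h); rewrite ?rmorphD // mcoeffD g1 h1 addr0.
  + have [h ->] := quot_map_surj a.
    by exists (h * g); rewrite ?rmorphM // mcoeff_ptrivM g1 mulr0.
- move=> [g g0]; rewrite -(rmorph1 q) => /(quot_map_ptriv v).
  by rewrite g0 [LHS]mcoeff_ptriv1 => /eqP; rewrite oner_eq0.
have [g xg] := quot_map_surj x; exists g => //; apply: contrapT => /eqP gv; apply: L1.
set k := g@_(ptriv v) in gv.
have -> : 1 = (k^-1%:A : A) * x + q (1 - k^-1 *: g).
  by rewrite rmorphB rmorph1 /= linearZ /= -scalerAl mul1r -xg addrC subrK.
apply: LD; first exact: LM.
apply: ML; exists (1 - k^-1 *: g) => //.
by rewrite mcoeffB [_@_ _]mcoeff_ptriv1 mcoeffZ -/k mulVf ?subrr.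
Qed.

Lemma jacobson_quot_paths_ge1 g : jacobson_radical A (q g) -> paths_ge 1 g.
Proof.
move=> Jg p; case E: (parrows p) => [|//] _; rewrite (parrows0 E).
have [h h0 gh] := Jg _ (vertex_maximal_left_ideal (pstart p)).
by rewrite (quot_map_ptriv _ gh).
Qed.

(** Elements of the radical lift to combinations of paths of positive length, so vanishing products
    of arrows would force the squared radical to be 0. *)
Lemma jacobson_square_arrows x : ideal_pow (jacobson_radical A) 2 x -> x <> 0 ->
  exists i j, ua i * ua j <> 0.
Proof.
move=> [n [a [b [ab ->]]]] x0; apply: contrapT => /forallNP uu0; apply: x0.
have {}uu0 i j : ua i * ua j = 0.
  by apply: contrapT => ij; apply: (uu0 i); exists j.
apply: big1 => k _; have [Ja [m [c [d [cd ->]]]]] := ab k.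
rewrite mulr_sumr big1 // => l _; have [Jc _] := cd l.
have [g gE] := quot_map_surj (a k); rewrite gE in Ja *.
have [h hE] := quot_map_surj (c l); rewrite hE in Jc *.
rewrite mulrA; suff -> : q g * q h = 0 by rewrite mul0r.
rewrite -rmorphM; apply/quot_map_eq0.
apply: (@paths_ge_sub _ _ 2); first exact: pideal_two_sided.
  case=> [|i [|j [|]]] // _; rewrite !big_cons big_nil mulr1.
  by apply/quot_map_eq0; rewrite rmorphM /= uu0.
by apply: (@paths_geM _ _ 1 1); apply: jacobson_quot_paths_ge1.
Qed.

End AdmissibleQuotient.

Theorem theoremC (K : closedFieldType) (Q : quiver)
    (I : proper_two_sided_ideal (path_alg K Q)) :
  admissible I ->
  fin_dim (quot_alg I) ->
  indecomposable (quot_alg I) ->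
  symmetric_algebra (quot_alg I) ->
  (forall x, ideal_pow (jacobson_radical (quot_alg I)) 3 x -> x = 0) ->
  (exists x, ideal_pow (jacobson_radical (quot_alg I)) 2 x /\ x <> 0) ->
  special_multiserial (quot_alg I) /\
  is_brauer_configuration_algebra (quot_alg I).
Proof.
move=> admI fdA indA [_ [f [fC fI]]] cubeJ [x [x2 x0]].
pose u i := quot_map I (arrow K i).
have cube i j k : u i * u j * u k = 0.
  (* The zeroth power in [ideal_pow] is the whole ring; the appended factor 1 lies in it. *)
  apply: cubeJ; rewrite -mulrA -[u k]mulr1.
  by do 3!(apply: ideal_mul_elt; first exact: jacobson_quot_arrow).
have [G v2 isoG] := symmetric_cube_zero_brauer (quot_vertexM I) (quot_vertex_sum I)
  (quot_vertex_neq0 admI) (@quot_src_arrow _ _ I) (@quot_arrow_tgt _ _ I)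
  (quot_span cube) cube (quot_arrow_indep admI) fC (symmetric_nondegenerate fC fI)
  (jacobson_square_arrows admI x2 x0) indA (qvertex_nonempty Q).
split; last by exists G.
(* The multiserial presentation is the Brauer one: the arrows of [Q] need not form a frame. *)
split=> //; exists (brauer_quiver G), (brauer_ideal K G); split.
- exact: brauer_ideal_admissible.
- by move=> a b b' /(brauer_ideal_arrowM v2)[-> _] /(brauer_ideal_arrowM v2)[-> _].
- by move=> a c c' /(brauer_ideal_arrowM v2)[_ ->] /(brauer_ideal_arrowM v2)[_ ->].
- exact: alg_isomorphic_morita.
Qed.
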